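(* Let $A$ be a symmetric Frobenius superalgebra over the commutative ring $\Bbbk$ with trace map of parity $\varepsilon$, and let $n\in\mathbb{N}$. As a superalgebra, $\mathrm{nilHecke}_n(A)=\operatorname{End}_{\mathcal{H}}(\mathsf{I}^{\otimes n})$, where $\mathcal{H}$ is the Frobenius nilHecke category of $A$ with generating object $\mathsf{I}$, is isomorphic to the free product of the Frobenius nilCoxeter algebra $\mathrm{nilCox}_n(A)$ and the free associative superalgebra on generators $x_1,\dots,x_n$ of parity $\varepsilon$, subject to the relations \begin{align*} x_ix_j&=(-1)^\varepsilon x_jx_i, & i\ne j,\\ \mathbf{a}x_i&=(-1)^{\varepsilon\bar{\mathbf{a}}}x_i\mathbf{a}, & \mathbf{a}\in A^{\otimes n},\ 1\le i\le n,\\ x_ju_i&=u_ix_j, & j\notin\{i,i+1\},\\ u_ix_{i+1}&=x_iu_i+\tau_i, & 1\le i\le n-1,\\ x_{i+1}u_i&=u_ix_i+(-1)^\varepsilon\tau_i, & 1\le i\le n-1. \end{align*}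
   Context: All superalgebras are associative, unital and $\mathbb{Z}/2$-graded over $\Bbbk$; $\bar a$ denotes parity; equations involving parities are for homogeneous elements and extended linearly; multiplication in $A\otimes B$ is $(a'\otimes b)(a\otimes b')=(-1)^{\bar a\bar b}a'a\otimes bb'$. A symmetric Frobenius superalgebra with trace of parity $\varepsilon\in\mathbb{Z}/2$ is a superalgebra $A$ with a homogeneous $\Bbbk$-linear map $\operatorname{tr}\colon A\to\Bbbk$ of parity $\varepsilon$ with $\operatorname{tr}(ab)=(-1)^{\bar a\bar b}\operatorname{tr}(ba)$, and such that $A$ has a (finite, homogeneous) $\Bbbk$-basis $\mathbf{B}_A$ with dual basis $\{b^\vee\}$ satisfying $\operatorname{tr}(a^\vee b)=\delta_{a,b}$ for $a,b\in\mathbf{B}_A$. Put $\tau=\sum_{b\in\mathbf{B}_A}(-1)^{\varepsilon\bar b}b\otimes b^\vee\in A^{\otimes2}$ and $\tau_i=1^{\otimes(n-i-1)}\otimes\tau\otimes1^{\otimes(i-1)}\in A^{\otimes n}$. Tensor factors are numbered from right to left. The simple transposition $s_i$ acts on $A^{\otimes n}$ (elements written $a_n\otimes\cdots\otimes a_1$) by swapping the $i$-th and $(i+1)$-st factors with sign $(-1)^{\bar a_i\bar a_{i+1}}$. A supercategory is a category enriched in $\Bbbk$-supermodules with parity-preserving composition. In a strict monoidal supercategory, $(f'\otimes g)\circ(f\otimes g')=(-1)^{\bar f\bar g}(f'\circ f)\otimes(g\circ g')$. The Frobenius nilHecke category $\mathcal{H}=\mathcal{H}(A)$ is the strict monoidal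 $\Bbbk$-linear supercategory generated by one object $\mathsf{I}$ and morphisms $X\colon\mathsf{I}^{\otimes2}\to\mathsf{I}^{\otimes2}$ (even; crossing), $d\colon\mathsf{I}\to\mathsf{I}$ (parity $\varepsilon$; dot), $t_a\colon\mathsf{I}\to\mathsf{I}$ for $a\in A$ (parity $\bar a$; tokens), subject to: $t_1=1_{\mathsf{I}}$; $t_{\lambda a+\mu b}=\lambda t_a+\mu t_b$ for $\lambda,\mu\in\Bbbk$; $t_a\circ t_b=t_{ab}$; $X\circ X=0$; $(X\otimes1_{\mathsf{I}})\circ(1_{\mathsf{I}}\otimes X)\circ(X\otimes1_{\mathsf{I}})=(1_{\mathsf{I}}\otimes X)\circ(X\otimes1_{\mathsf{I}})\circ(1_{\mathsf{I}}\otimes X)$; $X\circ(t_a\otimes1_{\mathsf{I}})=(1_{\mathsf{I}}\otimes t_a)\circ X$; $X\circ(1_{\mathsf{I}}\otimes t_a)=(t_a\otimes1_{\mathsf{I}})\circ X$; $X\circ(d\otimes1_{\mathsf{I}})-(1_{\mathsf{I}}\otimes d)\circ X=T$; $(d\otimes1_{\mathsf{I}})\circ X-X\circ(1_{\mathsf{I}}\otimes d)=(-1)^\varepsilon T$; $t_a\circ d=(-1)^{\varepsilon\bar a}d\circ t_a$; where $T=\sum_{b\in\mathbf{B}_A}(-1)^{\varepsilon\bar b}t_b\otimes t_{b^\vee}$. The Frobenius nilCoxeter algebra $\mathrm{nilCox}_n(A)$ is the superalgebra generated by the superalgebra $A^{\otimes n}$ and even elements $u_1,\dots,u_{n-1}$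 subject to $u_i^2=0$; $u_iu_j=u_ju_i$ for $|i-j|>1$; $u_iu_{i+1}u_i=u_{i+1}u_iu_{i+1}$; $u_i\mathbf{a}=s_i(\mathbf{a})u_i$ for $\mathbf{a}\in A^{\otimes n}$. *)

(* Defs.v *)
From HB Require Import structures.
From mathcomp Require Import all_boot all_order all_algebra all_fingroup.
From mathcomp Require Import boolp.

Set Implicit Arguments.
Unset Strict Implicit.
Unset Printing Implicit Defensive.

Import GRing.Theory.
Local Open Scope quotient_scope.
Local Open Scope ring_scope.

(* Z/2 is [bool], with [false] = even, [true] = odd, sum [(+)] and product
   [&&]. A Z/2-grading V = V_0 + V_1 is given by its two homogeneous projections
   [part false] and [part true].

   Superalgebras do not extend [algType], because the latter excludes the zero
   algebra, which is a symmetric Frobenius superalgebra (with empty basis), and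
   because the library has no possibly zero k-algebras. Hence the product [**]
   and the unit [sone] below. *)

HB.mixin Record isSuperModule (k : comPzRingType) V of GRing.Lmodule k V := {
  part : bool -> V -> V;
  part_linear : forall p (c : k) (x y : V),
    part p (c *: x + y) = c *: part p x + part p y;
  part_part : forall p q x, part p (part q x) = if p == q then part p x else 0;
  part_sum : forall x, part false x + part true x = x
}.

#[short(type="superModType")]
HB.structure Definition SuperModule (k : comPzRingType) :=
  {V of GRing.Lmodule k V & isSuperModule k V}.

HB.mixin Record isSuperAlgebra (k : comPzRingType) A of SuperModule k A := {
  sone : A;
  smul : A -> A -> A;
  smulA : associative smul;
  smul1l : left_id sone smul;
  smul1r : right_id sone smul;
  smulDl : left_distributive smul +%R;
  smulDr : right_distributive smul +%R;
  smulZl : forall (c : k) (x y : A), smul (c *: x) y = c *: smul x y;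
  smulZr : forall (c : k) (x y : A), smul x (c *: y) = c *: smul x y;
  part_sone : part false sone = sone;
  part_smul : forall p q (x y : A),
    part (p (+) q) (smul (part p x) (part q y)) = smul (part p x) (part q y)
}.

#[short(type="superAlgType")]
HB.structure Definition SuperAlgebra (k : comPzRingType) :=
  {A of SuperModule k A & isSuperAlgebra k A}.

Notation "x ** y" := (smul x y) (at level 40, left associativity) : ring_scope.

Definition homog (k : comPzRingType) (V : superModType k) (p : bool) (x : V) :=
  part p x = x.

Section SuperModuleTheory.
Variables (k : comPzRingType) (V : superModType k).
Implicit Types (p q : bool) (x y : V).

Lemma partD p x y : part p (x + y) = part p x + part p y.
Proof. by rewrite -{1}[x]scale1r part_linear scale1r. Qed.
Lemma part0 p : part p (0 : V) = 0.
Proof. by apply: (addrI (part p 0)); rewrite -partD addr0 addr0. Qed.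
Lemma partZ p c x : part p (c *: x) = c *: part p x.
Proof. by rewrite -[c *: x]addr0 part_linear part0 addr0. Qed.
Lemma homog_part p x : homog p (part p x).
Proof. by rewrite /homog part_part eqxx. Qed.
Lemma part_homog p q x : homog p x -> part q x = if q == p then x else 0.
Proof. by rewrite /homog => <-; rewrite part_part; case: eqP => // ->. Qed.
End SuperModuleTheory.

Section SuperAlgebraTheory.
Variables (k : comPzRingType) (A : superAlgType k).
Implicit Types (p q : bool) (x y : A).

Lemma homogM p q x y : homog p x -> homog q y -> homog (p (+) q) (x ** y).
Proof. by rewrite /homog => <- <-; rewrite part_smul. Qed.
Lemma smul0l x : 0 ** x = 0.
Proof. by have := smulZl 0 0 x; rewrite !scale0r. Qed.
Lemma smul0r x : x ** 0 = 0.
Proof. by have := smulZr 0 x 0; rewrite !scale0r. Qed.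
End SuperAlgebraTheory.

Definition superalg_iso (k : comPzRingType) (A B : superAlgType k) : Prop :=
  exists f : {linear A -> B},
    [/\ f sone = sone, {morph f : x y / x ** y},
        forall p x, f (part p x) = part p (f x) & bijective f].

Definition is_basis (k : comPzRingType) (V : lmodType k) (I : finType)
    (e : I -> V) : Prop :=
  forall x : V, exists! c : {ffun I -> k}, x = \sum_i c i *: e i.

Record symFrobenius (k : comPzRingType) (A : superAlgType k) (eps : bool) :=
  SymFrobenius {
    ftr : {scalar A};
    ftr_parity : forall p a, homog p a -> p != eps -> ftr a = 0;
    ftrC : forall p q a b, homog p a -> homog q b ->
      ftr (a ** b) = (-1) ^+ (p && q) * ftr (b ** a);
    fidx : finType;
    fbas : fidx -> A;
    fpar : fidx -> bool;
    fdual : fidx -> A;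
    fbas_homog : forall i, homog (fpar i) (fbas i);
    fbas_basis : is_basis fbas;
    fdual_basis : is_basis fdual;
    ftr_dual : forall i j, ftr (fdual i ** fbas j) = (i == j)%:R
  }.

Record equivalence (T : Type) (R : T -> T -> Prop) := Equivalence {
  eqv_refl : forall x, R x x;
  eqv_sym : forall x y, R x y -> R y x;
  eqv_trans : forall x y z, R x y -> R y z -> R x z
}.

Section PropQuotient.
Variables (T : Type) (R : T -> T -> Prop) (e : equivalence R).

Definition pquot_rel : rel {classic T} := fun x y => `[< R x y >].

Lemma pquot_equiv : equiv_class_of pquot_rel.
Proof.
split.
- by move=> x; apply/asboolP/(eqv_refl e).
- by move=> x y; apply/asboolP/asboolP => /(eqv_sym e).
- by move=> y x z /asboolP xy /asboolP yz; apply/asboolP/(eqv_trans e xy yz).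
Qed.

Canonical pquot_equiv_rel := EquivRelPack pquot_equiv.
Definition pquot := {eq_quot pquot_equiv_rel}.
HB.instance Definition _ := Choice.on pquot.

Definition cls (x : T) : pquot := \pi_pquot (x : {classic T}).
Definition rep (x : pquot) : T := generic_quotient.repr x.

Lemma repK x : cls (rep x) = x. Proof. exact: reprK. Qed.
Lemma clsP x y : cls x = cls y <-> R x y.
Proof.
split=> [/eqmodP/asboolP//|xy]; by apply/eqmodP/asboolP.
Qed.
Lemma rep_cls x : R (rep (cls x)) x. Proof. by apply/clsP; rewrite repK. Qed.
Lemma cls_ind (P : pquot -> Prop) : (forall x, P (cls x)) -> forall x, P x.
Proof. by move=> Px x; rewrite -(repK x). Qed.
End PropQuotient.

(* [tens A n] is the quotient of the free k-module on the tuples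
   (a_n, ..., a_1) by multilinearity. The tuple is a finite function on 'I_n,
   whose value at the index i is the factor number i + 1 from the right. *)

Lemma hi_subproof n (i : 'I_n.-1) : (i.+1 < n)%N.
Proof. by case: n i => [[]//|n] i; rewrite ltnS ltn_ord. Qed.
Definition lo n (i : 'I_n.-1) : 'I_n := widen_ord (leq_pred n) i.
Definition hi n (i : 'I_n.-1) : 'I_n := Ordinal (hi_subproof i).

Section TensorModule.
Variables (k : comPzRingType) (A : superAlgType k) (n : nat).
Local Notation tuples := {ffun 'I_n -> A}.

Definition upd (f : tuples) (i : 'I_n) (x : A) : tuples :=
  [ffun j => if j == i then x else f j].

Inductive tterm : Type :=
| TPure of tuples
| TZero
| TAdd of tterm & tterm
| TOpp of tterm
| TScale of k & tterm.

Inductive teq : tterm -> tterm -> Prop :=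
| teq_refl x : teq x x
| teq_sym x y : teq x y -> teq y x
| teq_trans x y z : teq x y -> teq y z -> teq x z
| teq_add x x' y y' : teq x x' -> teq y y' -> teq (TAdd x y) (TAdd x' y')
| teq_opp x x' : teq x x' -> teq (TOpp x) (TOpp x')
| teq_scale c x x' : teq x x' -> teq (TScale c x) (TScale c x')
| teq_addA x y z : teq (TAdd x (TAdd y z)) (TAdd (TAdd x y) z)
| teq_addC x y : teq (TAdd x y) (TAdd y x)
| teq_add0 x : teq (TAdd TZero x) x
| teq_addN x : teq (TAdd (TOpp x) x) TZero
| teq_scaleA c d x : teq (TScale c (TScale d x)) (TScale (c * d) x)
| teq_scale1 x : teq (TScale 1 x) x
| teq_scaleDr c x y :
    teq (TScale c (TAdd x y)) (TAdd (TScale c x) (TScale c y))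
| teq_scaleDl c d x :
    teq (TScale (c + d) x) (TAdd (TScale c x) (TScale d x))
| teq_multilinear f i c x y :
    teq (TPure (upd f i (c *: x + y)))
        (TAdd (TScale c (TPure (upd f i x))) (TPure (upd f i y))).

Lemma teq_equiv : equivalence teq.
Proof. exact: Equivalence teq_refl teq_sym teq_trans. Qed.

Definition tens := pquot teq_equiv.
HB.instance Definition _ := Choice.on tens.

Local Notation tcls := (cls teq_equiv).
Local Notation trep := (@rep _ _ teq_equiv).

Definition tadd (x y : tens) : tens := tcls (TAdd (trep x) (trep y)).
Definition topp (x : tens) : tens := tcls (TOpp (trep x)).
Definition tscale (c : k) (x : tens) : tens := tcls (TScale c (trep x)).

Lemma cls_tadd x y : tadd (tcls x) (tcls y) = tcls (TAdd x y).
Proof. by apply/clsP/teq_add; apply: rep_cls. Qed.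
Lemma cls_topp x : topp (tcls x) = tcls (TOpp x).
Proof. by apply/clsP/teq_opp; apply: rep_cls. Qed.
Lemma cls_tscale c x : tscale c (tcls x) = tcls (TScale c x).
Proof. by apply/clsP/teq_scale; apply: rep_cls. Qed.
Let clsE := (cls_tadd, cls_topp, cls_tscale).

Lemma taddA : associative tadd.
Proof.
elim/cls_ind=> x; elim/cls_ind=> y; elim/cls_ind=> z; rewrite !clsE.
exact/clsP/teq_addA.
Qed.
Lemma taddC : commutative tadd.
Proof.
elim/cls_ind=> x; elim/cls_ind=> y; rewrite !clsE; exact/clsP/teq_addC.
Qed.
Lemma tadd0 : left_id (tcls TZero) tadd.
Proof. elim/cls_ind=> x; rewrite !clsE; exact/clsP/teq_add0. Qed.
Lemma taddN : left_inverse (tcls TZero) topp tadd.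
Proof. elim/cls_ind=> x; rewrite !clsE; exact/clsP/teq_addN. Qed.
HB.instance Definition _ := GRing.isZmodule.Build tens taddA taddC tadd0 taddN.

Lemma tscaleA c d (x : tens) : tscale c (tscale d x) = tscale (c * d) x.
Proof. elim/cls_ind: x => x; rewrite !clsE; exact/clsP/teq_scaleA. Qed.
Lemma tscale1 : left_id 1 tscale.
Proof. elim/cls_ind=> x; rewrite !clsE; exact/clsP/teq_scale1. Qed.
Lemma tscaleDr : right_distributive tscale +%R.
Proof.
move=> c; elim/cls_ind=> x; elim/cls_ind=> y.
rewrite -[_ + _]/(tadd _ _) -[RHS]/(tadd _ _) !clsE; exact/clsP/teq_scaleDr.
Qed.
Lemma tscaleDl (v : tens) : {morph tscale^~ v : c d / c + d}.
Proof.
elim/cls_ind: v => x c d.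
rewrite -[RHS]/(tadd _ _) !clsE; exact/clsP/teq_scaleDl.
Qed.
HB.instance Definition _ := GRing.Zmodule_isLmodule.Build k tens
  tscaleA tscale1 tscaleDr tscaleDl.

Definition pure (f : tuples) : tens := tcls (TPure f).

Definition multilinear (M : lmodType k) (F : tuples -> M) : Prop :=
  forall f i c x y,
    F (upd f i (c *: x + y)) = c *: F (upd f i x) + F (upd f i y).

Lemma pure_multilinear : multilinear pure.
Proof.
move=> f i c x y; rewrite /pure -[RHS]/(tadd (tscale _ _) _) !clsE.
exact/clsP/teq_multilinear.
Qed.

Lemma tens_ind (P : tens -> Prop) :
  P 0 -> (forall c x y, P x -> P y -> P (c *: x + y)) ->
  (forall f, P (pure f)) -> forall x, P x.
Proof.
move=> P0 PL Pp; elim/cls_ind; elim=> [f||x Px y Py|x Px|c x Px].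
- exact: Pp.
- exact: P0.
- have := PL 1 _ _ Px Py; rewrite scale1r.
  by rewrite -[_ + _]/(tadd _ _) !clsE.
- have := PL (-1) _ _ Px P0; rewrite addr0 scaleN1r.
  by rewrite -[- _]/(topp _) !clsE.
- have := PL c _ _ Px P0; rewrite addr0.
  by rewrite -[_ *: _]/(tscale _ _) !clsE.
Qed.

Section Lift.
Variable M : lmodType k.
Implicit Types F : tuples -> M.

Fixpoint teval F (x : tterm) : M :=
  match x with
  | TPure f => F f
  | TZero => 0
  | TAdd x y => teval F x + teval F y
  | TOpp x => - teval F x
  | TScale c x => c *: teval F x
  end.

(* The linear map with [tlift F (pure f) = F f], if F is multilinear. *)
Definition tlift F (x : tens) : M := teval F (trep x).

Lemma teval_eq F x y : multilinear F -> teq x y -> teval F x = teval F y.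
Proof.
move=> mF; elim=> {x y} //=; intros; do ?congruence.
- by rewrite addrA.
- by rewrite addrC.
- by rewrite add0r.
- by rewrite addNr.
- by rewrite scalerA.
- by rewrite scale1r.
- by rewrite scalerDr.
- by rewrite scalerDl.
Qed.

Lemma tlift_cls F x : multilinear F -> tlift F (tcls x) = teval F x.
Proof. by move=> mF; apply: teval_eq => //; apply: rep_cls. Qed.

Lemma tlift_pure F f : multilinear F -> tlift F (pure f) = F f.
Proof. by move=> mF; rewrite tlift_cls. Qed.

Lemma tlift_linear F c x y : multilinear F ->
  tlift F (c *: x + y) = c *: tlift F x + tlift F y.
Proof.
move=> mF; elim/cls_ind: x => x; elim/cls_ind: y => y.
by rewrite -[X in tlift F X = _]/(tadd (tscale _ _) _) !clsE !tlift_cls.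
Qed.

Lemma tlift0 F : multilinear F -> tlift F 0 = 0.
Proof. by move=> mF; rewrite tlift_cls. Qed.
End Lift.

Lemma multilinear0 (M : lmodType k) (F : tuples -> M) (f : tuples) i :
  multilinear F -> f i = 0 -> F f = 0.
Proof.
move=> mF f0; have updf : upd f i 0 = f.
  by apply/ffunP=> j; rewrite ffunE; case: eqP => // ->.
have := mF f i 1 0 0; rewrite !scale1r addr0 updf => e.
by apply: (addrI (F f)); rewrite -e addr0.
Qed.

Lemma multilinear_sum (M : lmodType k) (I : Type) (r : seq I) (P : pred I)
    (a : I -> k) (F : I -> tuples -> M) :
  (forall i, multilinear (F i)) ->
  multilinear (fun f => \sum_(i <- r | P i) a i *: F i f).
Proof.
move=> mF f i c x y; rewrite scaler_sumr -big_split; apply: eq_bigr => j _ /=.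
by rewrite mF scalerDr !scalerA mulrC.
Qed.

Lemma multilinear_map (M : lmodType k) (F : tuples -> M) (s : {perm 'I_n})
    (g : 'I_n -> A -> A) :
  multilinear F ->
  (forall j c x y, g j (c *: x + y) = c *: g j x + g j y) ->
  multilinear (fun f => F [ffun j => g j (f (s j))]).
Proof.
move=> mF lg f i c x y.
have E z : [ffun j => g j (upd f i z (s j))] =
    upd [ffun j => g j (f (s j))] ((s^-1)%g i) (g ((s^-1)%g i) z).
  apply/ffunP=> j; rewrite !ffunE.
  have [-> | /eqP ne] := (j =P (s^-1)%g i); first by rewrite permKV eqxx.
  by case: eqP => // e; case/eqP: ne; rewrite -e permK.
by rewrite !E lg mF.
Qed.

Definition parts (p : {ffun 'I_n -> bool}) (a : tuples) : tuples :=
  [ffun i => part (p i) (a i)].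

Definition homogs (p : {ffun 'I_n -> bool}) (a : tuples) : Prop :=
  forall i, homog (p i) (a i).

Lemma parts_homogs p q a : homogs p a -> q != p -> exists i, parts q a i = 0.
Proof.
move=> ha ne; have /existsP [i hi] : [exists i, q i != p i].
  rewrite -negb_forall; apply: contra ne => /forallP e.
  by apply/eqP/ffunP => i; apply/eqP.
by exists i; rewrite ffunE (part_homog _ (ha i)) (negPf hi).
Qed.

Lemma parts_homogs_id p a : homogs p a -> parts p a = a.
Proof. by move=> ha; apply/ffunP => i; rewrite ffunE ha. Qed.

Lemma tens_homog_ind (P : tens -> Prop) :
  P 0 -> (forall c x y, P x -> P y -> P (c *: x + y)) ->
  (forall p f, homogs p f -> P (pure f)) -> forall x, P x.
Proof.
move=> P0 PL Pp; apply: tens_ind => // f.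
have H m : forall f : tuples,
    (forall i : 'I_n, (m <= i)%N -> exists p, homog p (f i)) -> P (pure f).
  elim: m => [|m IH] {}f hf.
    pose p := [ffun i => part true (f i) == f i].
    apply: (Pp p) => i; rewrite /p ffunE.
    case: eqP => [//|ne]; have [[] hq] := hf i isT; [by case: ne | exact: hq].
  have [lt|ge] := ltnP m n; last first.
    by apply: IH => i mi; have := leq_trans ge mi; rewrite leqNgt ltn_ord.
  pose i := Ordinal lt.
  have -> : f = upd f i (1 *: part false (f i) + part true (f i)).
    apply/ffunP=> j; rewrite ffunE scale1r part_sum.
    by case: eqP => // ->.
  rewrite pure_multilinear; apply: PL; apply: IH => j mj; rewrite ffunE.
  - case: eqP => [_|ne]; first by exists false; apply: homog_part.
    apply: hf; rewrite ltn_neqAle mj andbT; apply/eqP => e.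
    by apply: ne; apply: val_inj.
  - case: eqP => [_|ne]; first by exists true; apply: homog_part.
    apply: hf; rewrite ltn_neqAle mj andbT; apply/eqP => e.
    by apply: ne; apply: val_inj.
by apply: (H n) => i; rewrite leqNgt ltn_ord.
Qed.

Definition tpart_pure (e : bool) (a : tuples) : tens :=
  \sum_(p : {ffun 'I_n -> bool} | \big[addb/false]_i p i == e) pure (parts p a).

Lemma tpart_pureM e : multilinear (tpart_pure e).
Proof.
have -> : tpart_pure e = fun a =>
    \sum_(p : {ffun 'I_n -> bool} | \big[addb/false]_i p i == e)
       1 *: pure (parts p a).
  by apply/funext => a; apply: eq_bigr => p _; rewrite scale1r.
apply: multilinear_sum => p f i c x y.
have E g : parts p g = [ffun j => part (p j) (g ((1%g : {perm 'I_n}) j))].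
  by apply/ffunP=> j; rewrite !ffunE perm1.
rewrite !E.
apply: (@multilinear_map _ pure 1%g (fun j => part (p j)) pure_multilinear).
by move=> *; apply: part_linear.
Qed.

Definition tpart (e : bool) : tens -> tens := tlift (tpart_pure e).

Lemma tpart_homog e p a : homogs p a ->
  tpart e (pure a) = if e == \big[addb/false]_i p i then pure a else 0.
Proof.
move=> ha; rewrite /tpart tlift_pure; last exact: tpart_pureM.
have Z q : q != p -> pure (parts q a) = 0.
  by move=> ne; have [i] := parts_homogs ha ne; apply: multilinear0;
     apply: pure_multilinear.
case: eqP => [->|ne].
  rewrite /tpart_pure (bigD1 p) //= big1 ?addr0 ?parts_homogs_id //.
  by move=> q /andP[_ /Z].
rewrite /tpart_pure big1 // => q /eqP e'.
by apply: Z; apply: contra_notN ne => /eqP <-; rewrite -e'.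
Qed.

Lemma tpart_linear p c x y : tpart p (c *: x + y) = c *: tpart p x + tpart p y.
Proof. by apply: tlift_linear; apply: tpart_pureM. Qed.

Lemma tpart0 p : tpart p 0 = 0.
Proof. by apply: tlift0; apply: tpart_pureM. Qed.

Lemma tpart_part p q x :
  tpart p (tpart q x) = if p == q then tpart p x else 0.
Proof.
elim/tens_homog_ind: x => [|c x y Hx Hy|r f hf].
- by rewrite !tpart0 if_same.
- rewrite !tpart_linear Hx Hy; case: eqP => // _.
  by rewrite scaler0 addr0.
- rewrite !(tpart_homog _ hf); case: (q =P _) => [->|ne].
    by rewrite (tpart_homog _ hf); case: eqP.
  by rewrite tpart0; case: (p =P q) => // ->; case: eqP.
Qed.

Lemma tpart_sum x : tpart false x + tpart true x = x.
Proof.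
elim/tens_homog_ind: x => [|c x y Hx Hy|r f hf].
- by rewrite !tpart0 addr0.
- by rewrite !tpart_linear addrACA -scalerDr Hx Hy.
- rewrite !(tpart_homog _ hf); case: (\big[_/_]_i _) => /=.
    by rewrite add0r.
  by rewrite addr0.
Qed.

HB.instance Definition _ :=
  isSuperModule.Build k tens tpart_linear tpart_part tpart_sum.

(* The product (a_n ⊗ ... ⊗ a_1)(b_n ⊗ ... ⊗ b_1) of homogeneous pure tensors:
   b_i passes all the a_j with j < i. [tmul_pure] is the linear extension of this
   rule, stated as [tmul_homog]. *)
Definition ksign (p q : {ffun 'I_n -> bool}) : k :=
  \prod_(i < n) \prod_(j < n | (j < i)%N) (-1) ^+ (p j && q i).

Definition tmul_pure (a b : tuples) : tens :=
  \sum_(p : {ffun 'I_n -> bool}) \sum_(q : {ffun 'I_n -> bool})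
    ksign p q *: pure [ffun i => parts p a i ** parts q b i].

Definition tmul (x y : tens) : tens :=
  tlift (fun a => tlift (fun b => tmul_pure a b) y) x.

Definition tone : tens := pure [ffun=> sone].

Lemma tmul_pure_r a : multilinear (tmul_pure a).
Proof.
have -> : tmul_pure a = fun b : tuples =>
    \sum_(p : {ffun 'I_n -> bool}) 1 *:
    \sum_(q : {ffun 'I_n -> bool})
      ksign p q *: pure [ffun i => parts p a i ** parts q b i].
  by apply/funext => b; apply: eq_bigr => p _; rewrite scale1r.
apply: multilinear_sum => p; apply: multilinear_sum => q f i c x y.
have E g : [ffun i => parts p a i ** parts q g i] =
    [ffun j => parts p a j ** part (q j) (g ((1%g : {perm 'I_n}) j))].
  by apply/ffunP=> j; rewrite !ffunE perm1.
rewrite !E.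
apply: (@multilinear_map _ pure 1%g
         (fun j x => parts p a j ** part (q j) x) pure_multilinear).
by move=> *; rewrite part_linear smulDr smulZr.
Qed.

Lemma tmul_pure_l b : multilinear (tmul_pure^~ b).
Proof.
have -> : tmul_pure^~ b = fun a : tuples =>
    \sum_(p : {ffun 'I_n -> bool}) 1 *:
    \sum_(q : {ffun 'I_n -> bool})
      ksign p q *: pure [ffun i => parts p a i ** parts q b i].
  by apply/funext => a; apply: eq_bigr => p _; rewrite scale1r.
apply: multilinear_sum => p; apply: multilinear_sum => q f i c x y.
have E g : [ffun i => parts p g i ** parts q b i] =
    [ffun j => part (p j) (g ((1%g : {perm 'I_n}) j)) ** parts q b j].
  by apply/ffunP=> j; rewrite !ffunE perm1.
rewrite !E.
apply: (@multilinear_map _ pure 1%g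
         (fun j x => part (p j) x ** parts q b j) pure_multilinear).
by move=> *; rewrite part_linear smulDl smulZl.
Qed.

Lemma tmul_lift y : multilinear (fun a => tlift (tmul_pure a) y).
Proof.
elim/tens_ind: y => [|d u v Hu Hv|b] f i c x y.
- by rewrite !tlift0 ?scaler0 ?addr0 //; apply: tmul_pure_r.
- rewrite !(tlift_linear _ _ _ (tmul_pure_r _)) Hu Hv.
  by rewrite !scalerDr !scalerA addrACA (mulrC d).
- rewrite !tlift_pure; try exact: tmul_pure_r.
  exact: tmul_pure_l.
Qed.

Lemma tmul_linear_l c x x' y : tmul (c *: x + x') y = c *: tmul x y + tmul x' y.
Proof. exact/tlift_linear/tmul_lift. Qed.

Lemma tmul0l y : tmul 0 y = 0.
Proof. exact/tlift0/tmul_lift. Qed.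

Lemma tmul_linear_r c x y y' : tmul x (c *: y + y') = c *: tmul x y + tmul x y'.
Proof.
elim/tens_ind: x => [|d u v Hu Hv|a].
- by rewrite !tmul0l scaler0 addr0.
- by rewrite !tmul_linear_l Hu Hv !scalerDr !scalerA addrACA (mulrC d).
- rewrite /tmul !tlift_pure; try exact: tmul_lift.
  exact/tlift_linear/tmul_pure_r.
Qed.

Lemma tmul0r x : tmul x 0 = 0.
Proof.
have := tmul_linear_r 1 x 0 0; rewrite !scale1r addr0 => e.
by apply: (addrI (tmul x 0)); rewrite -e addr0.
Qed.

Lemma pure0 (f : tuples) i : f i = 0 -> pure f = 0.
Proof. exact: (multilinear0 pure_multilinear). Qed.

Lemma tmul_homog p q a b : homogs p a -> homogs q b ->
  tmul (pure a) (pure b) = ksign p q *: pure [ffun i => a i ** b i].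
Proof.
move=> ha hb; rewrite /tmul tlift_pure; last exact: tmul_lift.
rewrite tlift_pure; last exact: tmul_pure_r.
rewrite /tmul_pure (bigD1 p) //= [X in _ + X]big1 => [|p' ne]; last first.
  apply: big1 => q' _; have [i e] := parts_homogs ha ne.
  by rewrite (@pure0 _ i) ?scaler0 // ffunE e smul0l.
rewrite addr0 (bigD1 q) //= big1 => [|q' ne]; last first.
  have [i e] := parts_homogs hb ne.
  by rewrite (@pure0 _ i) ?scaler0 // ffunE e smul0r.
by rewrite addr0 !parts_homogs_id.
Qed.

Definition addp (p q : {ffun 'I_n -> bool}) : {ffun 'I_n -> bool} :=
  [ffun i => p i (+) q i].

Lemma homogs_mul p q a b : homogs p a -> homogs q b ->
  homogs (addp p q) [ffun i => a i ** b i].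
Proof. by move=> ha hb i; rewrite !ffunE; apply: homogM. Qed.

Lemma signrb (b c : bool) : (-1) ^+ (b (+) c) = (-1) ^+ b * (-1) ^+ c :> k.
Proof. by case: b; case: c; rewrite ?expr0 ?expr1 ?mul1r ?mulr1 ?mulrNN ?mulr1. Qed.

Lemma ksignDl p q r : ksign (addp p q) r = ksign p r * ksign q r.
Proof.
rewrite /ksign -big_split; apply: eq_bigr => i _ /=.
rewrite -big_split; apply: eq_bigr => j _ /=.
by rewrite ffunE andb_addl signrb.
Qed.

Lemma ksignDr p q r : ksign p (addp q r) = ksign p q * ksign p r.
Proof.
rewrite /ksign -big_split; apply: eq_bigr => i _ /=.
rewrite -big_split; apply: eq_bigr => j _ /=.
by rewrite ffunE andb_addr signrb.
Qed.

Let p0 : {ffun 'I_n -> bool} := [ffun=> false].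

Lemma homogs_one : homogs p0 [ffun=> sone].
Proof. by move=> i; rewrite !ffunE; apply: part_sone. Qed.

Lemma ksign0l q : ksign p0 q = 1.
Proof. by rewrite /ksign big1 // => i _; rewrite big1 // => j _; rewrite ffunE. Qed.
Lemma ksign0r q : ksign q p0 = 1.
Proof.
by rewrite /ksign big1 // => i _; rewrite big1 // => j _; rewrite ffunE andbF.
Qed.

Lemma tmul_one_l : left_id tone tmul.
Proof.
elim/tens_homog_ind => [|c x y Hx Hy|p f hf].
- exact: tmul0r.
- by rewrite tmul_linear_r Hx Hy.
- rewrite (tmul_homog homogs_one hf) ksign0l scale1r; congr pure.
  by apply/ffunP=> i; rewrite !ffunE smul1l.
Qed.

Lemma tmul_one_r : right_id tone tmul.
Proof.
elim/tens_homog_ind => [|c x y Hx Hy|p f hf].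
- exact: tmul0l.
- by rewrite tmul_linear_l Hx Hy.
- rewrite (tmul_homog hf homogs_one) ksign0r scale1r; congr pure.
  by apply/ffunP=> i; rewrite !ffunE smul1r.
Qed.

Lemma tmulZl c x y : tmul (c *: x) y = c *: tmul x y.
Proof. by have := tmul_linear_l c x 0 y; rewrite tmul0l !addr0. Qed.
Lemma tmulZr c x y : tmul x (c *: y) = c *: tmul x y.
Proof. by have := tmul_linear_r c x y 0; rewrite tmul0r !addr0. Qed.
Lemma tmulDl : left_distributive tmul +%R.
Proof. by move=> x y z; have := tmul_linear_l 1 x y z; rewrite !scale1r. Qed.
Lemma tmulDr : right_distributive tmul +%R.
Proof. by move=> x y z; have := tmul_linear_r 1 x y z; rewrite !scale1r. Qed.

Lemma tmulA : associative tmul.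
Proof.
move=> x y z.
elim/tens_homog_ind: x => [|c u v Hu Hv|p a ha].
- by rewrite !tmul0l.
- by rewrite !tmul_linear_l Hu Hv.
elim/tens_homog_ind: y => [|c u v Hu Hv|q b hb].
- by rewrite !(tmul0l, tmul0r).
- by rewrite !(tmul_linear_l, tmul_linear_r) Hu Hv.
elim/tens_homog_ind: z => [|c u v Hu Hv|r d hd].
- by rewrite !tmul0r.
- by rewrite !tmul_linear_r Hu Hv.
rewrite (tmul_homog hb hd) (tmul_homog ha hb) tmulZl tmulZr.
rewrite (tmul_homog ha (homogs_mul hb hd)) (tmul_homog (homogs_mul ha hb) hd).
rewrite !scalerA ksignDl ksignDr; congr (_ *: pure _).
  by rewrite mulrC mulrA.
by apply/ffunP=> i; rewrite !ffunE smulA.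
Qed.

Lemma tpart_one : tpart false tone = tone.
Proof.
rewrite (tpart_homog _ homogs_one) big1 ?eqxx // => i _.
by rewrite ffunE.
Qed.

Lemma tpart_mul p q x y :
  tpart (p (+) q) (tmul (tpart p x) (tpart q y)) = tmul (tpart p x) (tpart q y).
Proof.
elim/tens_homog_ind: x => [|c u v Hu Hv|r a ha].
- by rewrite tpart0 tmul0l tpart0.
- by rewrite tpart_linear tmul_linear_l tpart_linear Hu Hv.
elim/tens_homog_ind: y => [|c u v Hu Hv|s b hb].
- by rewrite tpart0 tmul0r tpart0.
- by rewrite tpart_linear tmul_linear_r tpart_linear Hu Hv.
rewrite (tpart_homog _ ha); case: eqP => [->|_]; last by rewrite tmul0l tpart0.
rewrite (tpart_homog _ hb); case: eqP => [->|_]; last by rewrite tmul0r tpart0.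
rewrite (tmul_homog ha hb).
have := tpart_linear (\big[addb/false]_i r i (+) \big[addb/false]_i s i)
  (ksign r s) (pure [ffun i => a i ** b i]) 0.
rewrite tpart0 !addr0 => ->; congr (_ *: _).
rewrite (tpart_homog _ (homogs_mul ha hb)) -big_split ifT //.
by apply/eqP; apply: eq_bigr => i _; rewrite ffunE.
Qed.

HB.instance Definition _ := isSuperAlgebra.Build k tens
  tmulA tmul_one_l tmul_one_r tmulDl tmulDr tmulZl tmulZr tpart_one tpart_mul.

(* As indices start from 0, [i : 'I_n.-1] stands for the simple transposition
   s_(i+1), of the factors at the indices [lo i] and [hi i], of values i and
   i + 1. The formula is the linear extension of [tswap_homog]. *)
Definition tswap_pure (i : 'I_n.-1) (a : tuples) : tens :=
  \sum_(p : {ffun 'I_n -> bool})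
    (-1) ^+ (p (lo i) && p (hi i)) *:
      pure [ffun l => parts p a (tperm (lo i) (hi i) l)].

Definition tswap (i : 'I_n.-1) : tens -> tens := tlift (tswap_pure i).

Lemma tswap_pureM i : multilinear (tswap_pure i).
Proof.
apply: multilinear_sum => p f l c x y; set s := tperm (lo i) (hi i).
have E g : [ffun l => parts p g (s l)] = [ffun l => part (p (s l)) (g (s l))].
  by apply/ffunP=> l'; rewrite !ffunE.
rewrite !E.
apply: (@multilinear_map _ pure s (fun l => part (p (s l))) pure_multilinear).
by move=> *; apply: part_linear.
Qed.

Lemma tswap_homog i p a : homogs p a ->
  tswap i (pure a) =
    (-1) ^+ (p (lo i) && p (hi i)) *:
      pure [ffun l => a (tperm (lo i) (hi i) l)].
Proof.
move=> ha; rewrite /tswap tlift_pure; last exact: tswap_pureM.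
rewrite /tswap_pure (bigD1 p) //= big1 => [|q ne]; last first.
  have [l e] := parts_homogs ha ne.
  by rewrite (@pure0 _ (tperm (lo i) (hi i) l)) ?scaler0 // ffunE tpermK e.
by rewrite addr0 parts_homogs_id.
Qed.
End TensorModule.

Arguments tens {k} A n.
Arguments pure {k A n}.

(* [tau F i] is 1 ⊗ ... ⊗ τ ⊗ ... ⊗ 1, where τ is the sum of the
   (-1)^(eps |b|) b ⊗ b^∨, with b at [hi i] and b^∨ at [lo i]. *)
Definition tau (k : comPzRingType) (A : superAlgType k) (eps : bool)
    (F : symFrobenius A eps) (n : nat) (i : 'I_n.-1) : tens A n :=
  \sum_(b : fidx F) (-1) ^+ (eps && fpar b) *:
    pure [ffun j => if j == hi i then fbas b
                    else if j == lo i then fdual b else sone].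

(* [presSA R] is the initial superalgebra with a map from G satisfying R: terms
   modulo the smallest congruence containing R and the superalgebra axioms.
   As [part] is an operation of the signature, the parity of a generator is
   itself a relation, and this congruence corresponds to the smallest
   homogeneous ideal. *)

Section Presentation.
Variables (k : comPzRingType) (G : Type).

Inductive saterm : Type :=
| SGen of G
| SZero
| SAdd of saterm & saterm
| SOpp of saterm
| SScale of k & saterm
| SOne
| SMul of saterm & saterm
| SPart of bool & saterm.

Variable R : saterm -> saterm -> Prop.

Inductive saeq : saterm -> saterm -> Prop :=
| saeq_rel x y : R x y -> saeq x y
| saeq_refl x : saeq x x
| saeq_sym x y : saeq x y -> saeq y x
| saeq_trans x y z : saeq x y -> saeq y z -> saeq x z
| saeq_add x x' y y' : saeq x x' -> saeq y y' -> saeq (SAdd x y) (SAdd x' y')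
| saeq_opp x x' : saeq x x' -> saeq (SOpp x) (SOpp x')
| saeq_scale c x x' : saeq x x' -> saeq (SScale c x) (SScale c x')
| saeq_mul x x' y y' : saeq x x' -> saeq y y' -> saeq (SMul x y) (SMul x' y')
| saeq_part p x x' : saeq x x' -> saeq (SPart p x) (SPart p x')
| saeq_addA x y z : saeq (SAdd x (SAdd y z)) (SAdd (SAdd x y) z)
| saeq_addC x y : saeq (SAdd x y) (SAdd y x)
| saeq_add0 x : saeq (SAdd SZero x) x
| saeq_addN x : saeq (SAdd (SOpp x) x) SZero
| saeq_scaleA c d x : saeq (SScale c (SScale d x)) (SScale (c * d) x)
| saeq_scale1 x : saeq (SScale 1 x) x
| saeq_scaleDr c x y :
    saeq (SScale c (SAdd x y)) (SAdd (SScale c x) (SScale c y))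
| saeq_scaleDl c d x :
    saeq (SScale (c + d) x) (SAdd (SScale c x) (SScale d x))
| saeq_part_linear p c x y :
    saeq (SPart p (SAdd (SScale c x) y))
         (SAdd (SScale c (SPart p x)) (SPart p y))
| saeq_part_part p q x :
    saeq (SPart p (SPart q x)) (if p == q then SPart p x else SZero)
| saeq_part_sum x : saeq (SAdd (SPart false x) (SPart true x)) x
| saeq_mulA x y z : saeq (SMul x (SMul y z)) (SMul (SMul x y) z)
| saeq_mul1l x : saeq (SMul SOne x) x
| saeq_mul1r x : saeq (SMul x SOne) x
| saeq_mulDl x y z : saeq (SMul (SAdd x y) z) (SAdd (SMul x z) (SMul y z))
| saeq_mulDr x y z : saeq (SMul x (SAdd y z)) (SAdd (SMul x y) (SMul x z))
| saeq_mulZl c x y : saeq (SMul (SScale c x) y) (SScale c (SMul x y))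
| saeq_mulZr c x y : saeq (SMul x (SScale c y)) (SScale c (SMul x y))
| saeq_part1 : saeq (SPart false SOne) SOne
| saeq_partM p q x y :
    saeq (SPart (p (+) q) (SMul (SPart p x) (SPart q y)))
         (SMul (SPart p x) (SPart q y)).

Lemma saeq_equiv : equivalence saeq.
Proof. exact: Equivalence saeq_refl saeq_sym saeq_trans. Qed.

Definition presSA := pquot saeq_equiv.
HB.instance Definition _ := Choice.on presSA.

Local Notation scls := (cls saeq_equiv).
Local Notation srep := (@rep _ _ saeq_equiv).

Definition sgen (g : G) : presSA := scls (SGen g).
Definition sadd (x y : presSA) : presSA := scls (SAdd (srep x) (srep y)).
Definition sopp (x : presSA) : presSA := scls (SOpp (srep x)).
Definition sscale (c : k) (x : presSA) : presSA := scls (SScale c (srep x)).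
Definition spart (p : bool) (x : presSA) : presSA := scls (SPart p (srep x)).
Definition sprod (x y : presSA) : presSA := scls (SMul (srep x) (srep y)).

Lemma cls_sadd x y : sadd (scls x) (scls y) = scls (SAdd x y).
Proof. by apply/clsP/saeq_add; apply: rep_cls. Qed.
Lemma cls_sopp x : sopp (scls x) = scls (SOpp x).
Proof. by apply/clsP/saeq_opp; apply: rep_cls. Qed.
Lemma cls_sscale c x : sscale c (scls x) = scls (SScale c x).
Proof. by apply/clsP/saeq_scale; apply: rep_cls. Qed.
Lemma cls_spart p x : spart p (scls x) = scls (SPart p x).
Proof. by apply/clsP/saeq_part; apply: rep_cls. Qed.
Lemma cls_sprod x y : sprod (scls x) (scls y) = scls (SMul x y).
Proof. by apply/clsP/saeq_mul; apply: rep_cls. Qed.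
Let clsE := (cls_sadd, cls_sopp, cls_sscale, cls_spart, cls_sprod).

Lemma saddA : associative sadd.
Proof.
elim/cls_ind=> x; elim/cls_ind=> y; elim/cls_ind=> z; rewrite !clsE.
exact/clsP/saeq_addA.
Qed.
Lemma saddC : commutative sadd.
Proof.
elim/cls_ind=> x; elim/cls_ind=> y; rewrite !clsE; exact/clsP/saeq_addC.
Qed.
Lemma sadd0 : left_id (scls SZero) sadd.
Proof. elim/cls_ind=> x; rewrite !clsE; exact/clsP/saeq_add0. Qed.
Lemma saddN : left_inverse (scls SZero) sopp sadd.
Proof. elim/cls_ind=> x; rewrite !clsE; exact/clsP/saeq_addN. Qed.
HB.instance Definition _ :=
  GRing.isZmodule.Build presSA saddA saddC sadd0 saddN.

Lemma sscaleA c d (x : presSA) : sscale c (sscale d x) = sscale (c * d) x.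
Proof. elim/cls_ind: x => x; rewrite !clsE; exact/clsP/saeq_scaleA. Qed.
Lemma sscale1 : left_id 1 sscale.
Proof. elim/cls_ind=> x; rewrite !clsE; exact/clsP/saeq_scale1. Qed.
Lemma sscaleDr : right_distributive sscale sadd.
Proof.
move=> c; elim/cls_ind=> x; elim/cls_ind=> y; rewrite !clsE.
exact/clsP/saeq_scaleDr.
Qed.
Lemma sscaleDl (v : presSA) c d : sscale (c + d) v = sadd (sscale c v) (sscale d v).
Proof. elim/cls_ind: v => x; rewrite !clsE; exact/clsP/saeq_scaleDl. Qed.
HB.instance Definition _ := GRing.Zmodule_isLmodule.Build k presSA
  sscaleA sscale1 sscaleDr sscaleDl.

Lemma spart_linear p c x y :
  spart p (sadd (sscale c x) y) = sadd (sscale c (spart p x)) (spart p y).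
Proof.
elim/cls_ind: x => x; elim/cls_ind: y => y; rewrite !clsE.
exact/clsP/saeq_part_linear.
Qed.
Lemma spart_part p q x :
  spart p (spart q x) = if p == q then spart p x else scls SZero.
Proof.
elim/cls_ind: x => x; rewrite !clsE; have := saeq_part_part p q x.
by case: eqP => _ H; apply/clsP.
Qed.
Lemma spart_sum x : sadd (spart false x) (spart true x) = x.
Proof. elim/cls_ind: x => x; rewrite !clsE; exact/clsP/saeq_part_sum. Qed.
HB.instance Definition _ :=
  isSuperModule.Build k presSA spart_linear spart_part spart_sum.

Lemma sprodA : associative sprod.
Proof.
elim/cls_ind=> x; elim/cls_ind=> y; elim/cls_ind=> z; rewrite !clsE.
exact/clsP/saeq_mulA.
Qed.
Lemma sprod1l : left_id (scls SOne) sprod.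
Proof. elim/cls_ind=> x; rewrite !clsE; exact/clsP/saeq_mul1l. Qed.
Lemma sprod1r : right_id (scls SOne) sprod.
Proof. elim/cls_ind=> x; rewrite !clsE; exact/clsP/saeq_mul1r. Qed.
Lemma sprodDl : left_distributive sprod sadd.
Proof.
elim/cls_ind=> x; elim/cls_ind=> y; elim/cls_ind=> z; rewrite !clsE.
exact/clsP/saeq_mulDl.
Qed.
Lemma sprodDr : right_distributive sprod sadd.
Proof.
elim/cls_ind=> x; elim/cls_ind=> y; elim/cls_ind=> z; rewrite !clsE.
exact/clsP/saeq_mulDr.
Qed.
Lemma sprodZl c x y : sprod (sscale c x) y = sscale c (sprod x y).
Proof.
elim/cls_ind: x => x; elim/cls_ind: y => y; rewrite !clsE.
exact/clsP/saeq_mulZl.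
Qed.
Lemma sprodZr c x y : sprod x (sscale c y) = sscale c (sprod x y).
Proof.
elim/cls_ind: x => x; elim/cls_ind: y => y; rewrite !clsE.
exact/clsP/saeq_mulZr.
Qed.
Lemma spart1 : spart false (scls SOne) = scls SOne.
Proof. rewrite !clsE; exact/clsP/saeq_part1. Qed.
Lemma spartM p q x y :
  spart (p (+) q) (sprod (spart p x) (spart q y)) =
  sprod (spart p x) (spart q y).
Proof.
elim/cls_ind: x => x; elim/cls_ind: y => y; rewrite !clsE.
exact/clsP/saeq_partM.
Qed.
HB.instance Definition _ := isSuperAlgebra.Build k presSA
  sprodA sprod1l sprod1r sprodDl sprodDr sprodZl sprodZr spart1 spartM.
End Presentation.

Arguments SGen {k G}.
Arguments SZero {k G}.
Arguments SOne {k G}.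

Inductive hom_rel (k : comPzRingType) (S : superAlgType k) (G : Type)
    (j : S -> saterm k G) : saterm k G -> saterm k G -> Prop :=
| hom_rel_linear c x y :
    hom_rel j (j (c *: x + y)) (SAdd (SScale c (j x)) (j y))
| hom_rel_one : hom_rel j (j sone) SOne
| hom_rel_mul x y : hom_rel j (j (x ** y)) (SMul (j x) (j y))
| hom_rel_part p x : hom_rel j (j (part p x)) (SPart p (j x)).

Section FreeSuperalgebra.
Variables (k : comPzRingType) (G : Type) (par : G -> bool).

Inductive free_rel : saterm k G -> saterm k G -> Prop :=
| free_rel_par g : free_rel (SPart (par g) (SGen g)) (SGen g).

Definition freeSA := presSA free_rel.
HB.instance Definition _ := SuperAlgebra.on freeSA.

Definition free_gen (g : G) : freeSA := sgen free_rel g.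
End FreeSuperalgebra.

Arguments freeSA k {G} par.
Arguments free_gen k {G} par.

Section FreeProduct.
Variables (k : comPzRingType) (S T : superAlgType k).

Inductive fprod_rel : saterm k (S + T) -> saterm k (S + T) -> Prop :=
| fprod_rel_l x y : hom_rel (fun s => SGen (inl s)) x y -> fprod_rel x y
| fprod_rel_r x y : hom_rel (fun t => SGen (inr t)) x y -> fprod_rel x y.

Definition freeProd := presSA fprod_rel.
HB.instance Definition _ := SuperAlgebra.on freeProd.

Definition fp_inl (s : S) : freeProd := sgen fprod_rel (inl s).
Definition fp_inr (t : T) : freeProd := sgen fprod_rel (inr t).
End FreeProduct.

Section QuotientSuperalgebra.
Variables (k : comPzRingType) (S : superAlgType k) (R : S -> S -> Prop).

Inductive quot_rel : saterm k S -> saterm k S -> Prop :=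
| quot_rel_hom x y : hom_rel SGen x y -> quot_rel x y
| quot_rel_rel a b : R a b -> quot_rel (SGen a) (SGen b).

Definition quotSA := presSA quot_rel.
HB.instance Definition _ := SuperAlgebra.on quotSA.

Definition quot_proj (s : S) : quotSA := sgen quot_rel s.
End QuotientSuperalgebra.

Section NilCoxeter.
Variables (k : comPzRingType) (A : superAlgType k) (n : nat).

Definition nilCox_base :=
  freeProd (tens A n) (freeSA k (fun _ : 'I_n.-1 => false)).
HB.instance Definition _ := SuperAlgebra.on nilCox_base.

Local Notation u i := (fp_inr _ (free_gen k _ i) : nilCox_base).
Local Notation inA a := (fp_inl _ a : nilCox_base).

Inductive nilCox_rel : nilCox_base -> nilCox_base -> Prop :=
| nilCox_sq i : nilCox_rel (u i ** u i) 0
| nilCox_far (i j : 'I_n.-1) : (i.+1 < j)%N || (j.+1 < i)%N ->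
    nilCox_rel (u i ** u j) (u j ** u i)
| nilCox_braid (i j : 'I_n.-1) : j = i.+1 :> nat ->
    nilCox_rel (u i ** u j ** u i) (u j ** u i ** u j)
| nilCox_swap i a : nilCox_rel (u i ** inA a) (inA (tswap i a) ** u i).

Definition nilCox := quotSA nilCox_rel.
HB.instance Definition _ := SuperAlgebra.on nilCox.

Definition nilCox_u (i : 'I_n.-1) : nilCox := quot_proj nilCox_rel (u i).
Definition nilCox_A (a : tens A n) : nilCox := quot_proj nilCox_rel (inA a).
End NilCoxeter.

Section NilHeckePresentation.
Variables (k : comPzRingType) (A : superAlgType k) (eps : bool).
Variables (F : symFrobenius A eps) (n : nat).

Definition nilHecke_base := freeProd (nilCox A n) (freeSA k (fun _ : 'I_n => eps)).
HB.instance Definition _ := SuperAlgebra.on nilHecke_base.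

Local Notation u i := (fp_inl _ (nilCox_u A i) : nilHecke_base).
Local Notation inA a := (fp_inl _ (nilCox_A a) : nilHecke_base).
Local Notation x i := (fp_inr _ (free_gen k _ i) : nilHecke_base).

Inductive nilHecke_rel : nilHecke_base -> nilHecke_base -> Prop :=
| nilHecke_xx i j : i != j ->
    nilHecke_rel (x i ** x j) ((-1) ^+ eps *: (x j ** x i))
| nilHecke_ax p a i : homog p a ->
    nilHecke_rel (inA a ** x i) ((-1) ^+ (eps && p) *: (x i ** inA a))
| nilHecke_xu i j : j != lo i -> j != hi i ->
    nilHecke_rel (x j ** u i) (u i ** x j)
| nilHecke_ux i :
    nilHecke_rel (u i ** x (hi i)) (x (lo i) ** u i + inA (tau F i))
| nilHecke_xu' i :
    nilHecke_rel (x (hi i) ** u i)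
                 (u i ** x (lo i) + (-1) ^+ eps *: inA (tau F i)).

Definition nilHeckePres := quotSA nilHecke_rel.
HB.instance Definition _ := SuperAlgebra.on nilHeckePres.
End NilHeckePresentation.

(* The objects of the category are the I^(⊗n), n : nat, with
   I^(⊗m) ⊗ I^(⊗n) = I^(⊗(m + n)). Morphisms are terms over the signature of
   strict monoidal supercategories, modulo the smallest congruence containing
   the axioms of these and the defining relations. The congruence is
   heterogeneous because strict associativity and unitality of ⊗ relate terms
   whose types are only propositionally equal; it never relates morphisms with
   different domains or codomains. *)

Section NilHeckeCategory.
Variables (k : comPzRingType) (A : superAlgType k) (eps : bool).

Inductive hterm : nat -> nat -> Type :=
| HZero m n : hterm m n
| HAdd m n of hterm m n & hterm m n : hterm m n
| HOpp m n of hterm m n : hterm m n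
| HScale m n of k & hterm m n : hterm m n
| HPart m n of bool & hterm m n : hterm m n
| HId n : hterm n n
| HComp m n l of hterm n l & hterm m n : hterm m l
| HTens m n m' n' of hterm m n & hterm m' n' : hterm (m + m') (n + n')
| HCross : hterm 2 2
| HDot : hterm 1 1
| HTok of A : hterm 1 1.

Arguments HZero {m n}.

Local Notation "f ∘ g" := (HComp f g) (at level 40, left associativity).
Local Notation "f ⊗ g" := (HTens f g) (at level 38, left associativity).
Local Notation "f ⊕ g" := (HAdd f g) (at level 50, left associativity).
Local Notation "f ⊖ g" := (HAdd f (HOpp g)) (at level 50, left associativity).
Local Notation "c ⋅ f" := (HScale c f) (at level 39, left associativity).
Local Notation "1_ n" := (HId n) (at level 1, n at level 0, format "1_ n").
Local Notation X := HCross.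
Local Notation d := HDot.
Local Notation t := HTok.

Variable F : symFrobenius A eps.

Definition HTau : hterm 2 2 :=
  \big[@HAdd 2 2/HZero]_(b : fidx F)
    ((-1) ^+ (eps && fpar b) ⋅ (t (fbas b) ⊗ t (fdual b))).

Inductive heq : forall m n, hterm m n -> forall m' n', hterm m' n' -> Prop :=
| heq_refl m n (f : hterm m n) : heq f f
| heq_sym m n m' n' (f : hterm m n) (g : hterm m' n') : heq f g -> heq g f
| heq_trans m n m' n' m'' n''
    (f : hterm m n) (g : hterm m' n') (h : hterm m'' n'') :
    heq f g -> heq g h -> heq f h
| heq_add m n m' n' (f g : hterm m n) (f' g' : hterm m' n') :
    heq f f' -> heq g g' -> heq (f ⊕ g) (f' ⊕ g')
| heq_opp m n m' n' (f : hterm m n) (f' : hterm m' n') :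
    heq f f' -> heq (HOpp f) (HOpp f')
| heq_scale c m n m' n' (f : hterm m n) (f' : hterm m' n') :
    heq f f' -> heq (c ⋅ f) (c ⋅ f')
| heq_part p m n m' n' (f : hterm m n) (f' : hterm m' n') :
    heq f f' -> heq (HPart p f) (HPart p f')
| heq_comp m n l m' n' l' (f : hterm n l) (g : hterm m n)
    (f' : hterm n' l') (g' : hterm m' n') :
    heq f f' -> heq g g' -> heq (f ∘ g) (f' ∘ g')
| heq_tens m1 n1 m2 n2 m1' n1' m2' n2' (f : hterm m1 n1) (g : hterm m2 n2)
    (f' : hterm m1' n1') (g' : hterm m2' n2') :
    heq f f' -> heq g g' -> heq (f ⊗ g) (f' ⊗ g')
| heq_addA m n (f g h : hterm m n) : heq (f ⊕ (g ⊕ h)) (f ⊕ g ⊕ h)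
| heq_addC m n (f g : hterm m n) : heq (f ⊕ g) (g ⊕ f)
| heq_add0 m n (f : hterm m n) : heq (HZero ⊕ f) f
| heq_addN m n (f : hterm m n) : heq (HOpp f ⊕ f) (@HZero m n)
| heq_scaleA m n c c' (f : hterm m n) : heq (c ⋅ (c' ⋅ f)) ((c * c') ⋅ f)
| heq_scale1 m n (f : hterm m n) : heq (1 ⋅ f) f
| heq_scaleDr m n c (f g : hterm m n) : heq (c ⋅ (f ⊕ g)) (c ⋅ f ⊕ c ⋅ g)
| heq_scaleDl m n c c' (f : hterm m n) : heq ((c + c') ⋅ f) (c ⋅ f ⊕ c' ⋅ f)
| heq_part_linear m n p c (f g : hterm m n) :
    heq (HPart p (c ⋅ f ⊕ g)) (c ⋅ HPart p f ⊕ HPart p g)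
| heq_part_part m n p q (f : hterm m n) :
    heq (HPart p (HPart q f)) (if p == q then HPart p f else HZero)
| heq_part_sum m n (f : hterm m n) : heq (HPart false f ⊕ HPart true f) f
| heq_compA m n l r (f : hterm l r) (g : hterm n l) (h : hterm m n) :
    heq (f ∘ (g ∘ h)) (f ∘ g ∘ h)
| heq_id_l m n (f : hterm m n) : heq (1_ n ∘ f) f
| heq_id_r m n (f : hterm m n) : heq (f ∘ 1_ m) f
| heq_compDl m n l (f g : hterm n l) (h : hterm m n) :
    heq ((f ⊕ g) ∘ h) (f ∘ h ⊕ g ∘ h)
| heq_compDr m n l (f : hterm n l) (g h : hterm m n) :
    heq (f ∘ (g ⊕ h)) (f ∘ g ⊕ f ∘ h)
| heq_compZl m n l c (f : hterm n l) (g : hterm m n) :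
    heq ((c ⋅ f) ∘ g) (c ⋅ (f ∘ g))
| heq_compZr m n l c (f : hterm n l) (g : hterm m n) :
    heq (f ∘ (c ⋅ g)) (c ⋅ (f ∘ g))
| heq_part_id n : heq (HPart false 1_ n) 1_ n
| heq_part_comp m n l p q (f : hterm n l) (g : hterm m n) :
    heq (HPart (p (+) q) (HPart p f ∘ HPart q g)) (HPart p f ∘ HPart q g)
| heq_tensA m1 n1 m2 n2 m3 n3
    (f : hterm m1 n1) (g : hterm m2 n2) (h : hterm m3 n3) :
    heq (f ⊗ (g ⊗ h)) (f ⊗ g ⊗ h)
| heq_tens1l m n (f : hterm m n) : heq (1_ 0 ⊗ f) f
| heq_tens1r m n (f : hterm m n) : heq (f ⊗ 1_ 0) f
| heq_tens_id m n : heq (1_ m ⊗ 1_ n) 1_ (m + n)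
| heq_tensDl m n m' n' (f g : hterm m n) (h : hterm m' n') :
    heq ((f ⊕ g) ⊗ h) (f ⊗ h ⊕ g ⊗ h)
| heq_tensDr m n m' n' (f : hterm m n) (g h : hterm m' n') :
    heq (f ⊗ (g ⊕ h)) (f ⊗ g ⊕ f ⊗ h)
| heq_tensZl m n m' n' c (f : hterm m n) (g : hterm m' n') :
    heq ((c ⋅ f) ⊗ g) (c ⋅ (f ⊗ g))
| heq_tensZr m n m' n' c (f : hterm m n) (g : hterm m' n') :
    heq (f ⊗ (c ⋅ g)) (c ⋅ (f ⊗ g))
| heq_part_tens m n m' n' p q (f : hterm m n) (g : hterm m' n') :
    heq (HPart (p (+) q) (HPart p f ⊗ HPart q g)) (HPart p f ⊗ HPart q g)
| heq_interchange m n l m' n' l' p q (f' : hterm n l) (g : hterm n' l')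
    (f : hterm m n) (g' : hterm m' n') :
    heq ((f' ⊗ HPart q g) ∘ (HPart p f ⊗ g'))
        ((-1) ^+ (p && q) ⋅ ((f' ∘ HPart p f) ⊗ (HPart q g ∘ g')))
| heq_par_cross : heq (HPart false X) X
| heq_par_dot : heq (HPart eps d) d
| heq_par_tok p a : heq (HPart p (t a)) (t (part p a))
| heq_tok1 : heq (t sone) 1_ 1
| heq_tok_linear c c' a b :
    heq (t (c *: a + c' *: b)) (c ⋅ t a ⊕ c' ⋅ t b)
| heq_tokM a b : heq (t a ∘ t b) (t (a ** b))
| heq_cross_sq : heq (X ∘ X) (@HZero 2 2)
| heq_braid :
    heq ((X ⊗ 1_ 1 : hterm 3 3) ∘ (1_ 1 ⊗ X : hterm 3 3) ∘ (X ⊗ 1_ 1 : hterm 3 3))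
        ((1_ 1 ⊗ X : hterm 3 3) ∘ (X ⊗ 1_ 1 : hterm 3 3) ∘ (1_ 1 ⊗ X : hterm 3 3))
| heq_cross_tok_l a : heq (X ∘ (t a ⊗ 1_ 1)) ((1_ 1 ⊗ t a) ∘ X)
| heq_cross_tok_r a : heq (X ∘ (1_ 1 ⊗ t a)) ((t a ⊗ 1_ 1) ∘ X)
| heq_cross_dot : heq (X ∘ (d ⊗ 1_ 1) ⊖ (1_ 1 ⊗ d) ∘ X) HTau
| heq_dot_cross :
    heq ((d ⊗ 1_ 1) ∘ X ⊖ X ∘ (1_ 1 ⊗ d)) ((-1) ^+ eps ⋅ HTau)
| heq_tok_dot p a : homog p a -> heq (t a ∘ d) ((-1) ^+ (eps && p) ⋅ (d ∘ t a)).

Definition heq_hom m n (f g : hterm m n) : Prop := heq f g.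

Lemma heq_equiv m n : equivalence (@heq_hom m n).
Proof.
split=> [f|f g fg|f g h fg gh].
- exact: heq_refl.
- exact: heq_sym fg.
- exact: heq_trans fg gh.
Qed.

Definition hhom m n := pquot (heq_equiv m n).
HB.instance Definition _ m n := Choice.on (hhom m n).

Local Notation hcls := (cls (heq_equiv _ _)).
Local Notation hrep := (@rep _ _ (heq_equiv _ _)).

Definition hzero m n : hhom m n := hcls HZero.
Definition hadd m n (f g : hhom m n) : hhom m n := hcls (hrep f ⊕ hrep g).
Definition hopp m n (f : hhom m n) : hhom m n := hcls (HOpp (hrep f)).
Definition hscale m n (c : k) (f : hhom m n) : hhom m n := hcls (c ⋅ hrep f).
Definition hpart m n (p : bool) (f : hhom m n) : hhom m n :=
  hcls (HPart p (hrep f)).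
Definition hid n : hhom n n := hcls 1_ n.
Definition hcomp m n l (f : hhom n l) (g : hhom m n) : hhom m l :=
  hcls (hrep f ∘ hrep g).
Definition htens m n m' n' (f : hhom m n) (g : hhom m' n') :
  hhom (m + m') (n + n') := hcls (hrep f ⊗ hrep g).

Lemma hrep_cls m n (f : hterm m n) : heq (hrep (hcls f)) f.
Proof. exact: (rep_cls (heq_equiv m n) f). Qed.

Lemma cls_hadd m n (f g : hterm m n) : hadd (hcls f) (hcls g) = hcls (f ⊕ g).
Proof. by apply/clsP; apply: heq_add; apply: hrep_cls. Qed.
Lemma cls_hopp m n (f : hterm m n) : hopp (hcls f) = hcls (HOpp f).
Proof. by apply/clsP; apply: heq_opp; apply: hrep_cls. Qed.
Lemma cls_hscale m n c (f : hterm m n) : hscale c (hcls f) = hcls (c ⋅ f).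
Proof. by apply/clsP; apply: heq_scale; apply: hrep_cls. Qed.
Lemma cls_hpart m n p (f : hterm m n) : hpart p (hcls f) = hcls (HPart p f).
Proof. by apply/clsP; apply: heq_part; apply: hrep_cls. Qed.
Lemma cls_hcomp m n l (f : hterm n l) (g : hterm m n) :
  hcomp (hcls f) (hcls g) = hcls (f ∘ g).
Proof. by apply/clsP; apply: heq_comp; apply: hrep_cls. Qed.
Lemma cls_htens m n m' n' (f : hterm m n) (g : hterm m' n') :
  htens (hcls f) (hcls g) = hcls (f ⊗ g).
Proof. by apply/clsP; apply: heq_tens; apply: hrep_cls. Qed.
Let clsE := (cls_hadd, cls_hopp, cls_hscale, cls_hpart, cls_hcomp).

Section HomSupermodule.
Variables m n : nat.
Implicit Types f g h : hhom m n.

Lemma haddA : associative (@hadd m n).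
Proof.
elim/cls_ind=> x; elim/cls_ind=> y; elim/cls_ind=> z; rewrite !clsE.
apply/clsP; exact: heq_addA.
Qed.
Lemma haddC : commutative (@hadd m n).
Proof.
elim/cls_ind=> x; elim/cls_ind=> y; rewrite !clsE; apply/clsP; exact: heq_addC.
Qed.
Lemma hadd0 : left_id (hzero m n) (@hadd m n).
Proof. elim/cls_ind=> x; rewrite !clsE; apply/clsP; exact: heq_add0. Qed.
Lemma haddN : left_inverse (hzero m n) (@hopp m n) (@hadd m n).
Proof. elim/cls_ind=> x; rewrite !clsE; apply/clsP; exact: heq_addN. Qed.
HB.instance Definition _ :=
  GRing.isZmodule.Build (hhom m n) haddA haddC hadd0 haddN.

Lemma hscaleA c c' f : hscale c (hscale c' f) = hscale (c * c') f.
Proof. elim/cls_ind: f => x; rewrite !clsE; apply/clsP; exact: heq_scaleA. Qed.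
Lemma hscale1 : left_id 1 (@hscale m n).
Proof. elim/cls_ind=> x; rewrite !clsE; apply/clsP; exact: heq_scale1. Qed.
Lemma hscaleDr : right_distributive (@hscale m n) (@hadd m n).
Proof.
move=> c; elim/cls_ind=> x; elim/cls_ind=> y; rewrite !clsE.
apply/clsP; exact: heq_scaleDr.
Qed.
Lemma hscaleDl f c c' : hscale (c + c') f = hadd (hscale c f) (hscale c' f).
Proof. elim/cls_ind: f => x; rewrite !clsE; apply/clsP; exact: heq_scaleDl. Qed.
HB.instance Definition _ := GRing.Zmodule_isLmodule.Build k (hhom m n)
  hscaleA hscale1 hscaleDr hscaleDl.

Lemma hpart_linear p c f g :
  hpart p (hadd (hscale c f) g) = hadd (hscale c (hpart p f)) (hpart p g).
Proof.
elim/cls_ind: f => x; elim/cls_ind: g => y; rewrite !clsE.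
apply/clsP; exact: heq_part_linear.
Qed.
Lemma hpart_part p q f :
  hpart p (hpart q f) = if p == q then hpart p f else hzero m n.
Proof.
elim/cls_ind: f => x; rewrite !clsE; have := heq_part_part p q x.
by case: eqP => _ H; apply/clsP.
Qed.
Lemma hpart_sum f : hadd (hpart false f) (hpart true f) = f.
Proof. elim/cls_ind: f => x; rewrite !clsE; apply/clsP; exact: heq_part_sum. Qed.
HB.instance Definition _ :=
  isSuperModule.Build k (hhom m n) hpart_linear hpart_part hpart_sum.
End HomSupermodule.

Definition nilHecke (n : nat) := hhom n n.

Section Endomorphisms.
Variable n : nat.
HB.instance Definition _ := SuperModule.on (nilHecke n).

Lemma hcompA : associative (@hcomp n n n).
Proof.
elim/cls_ind=> x; elim/cls_ind=> y; elim/cls_ind=> z; rewrite !clsE.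
apply/clsP; exact: heq_compA.
Qed.
Lemma hcomp1l : left_id (hid n) (@hcomp n n n).
Proof. elim/cls_ind=> x; rewrite !clsE; apply/clsP; exact: heq_id_l. Qed.
Lemma hcomp1r : right_id (hid n) (@hcomp n n n).
Proof. elim/cls_ind=> x; rewrite !clsE; apply/clsP; exact: heq_id_r. Qed.
Lemma hcompDl : left_distributive (@hcomp n n n) (@hadd n n).
Proof.
elim/cls_ind=> x; elim/cls_ind=> y; elim/cls_ind=> z; rewrite !clsE.
apply/clsP; exact: heq_compDl.
Qed.
Lemma hcompDr : right_distributive (@hcomp n n n) (@hadd n n).
Proof.
elim/cls_ind=> x; elim/cls_ind=> y; elim/cls_ind=> z; rewrite !clsE.
apply/clsP; exact: heq_compDr.
Qed.
Lemma hcompZl c (f g : hhom n n) : hcomp (hscale c f) g = hscale c (hcomp f g).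
Proof.
elim/cls_ind: f => x; elim/cls_ind: g => y; rewrite !clsE.
apply/clsP; exact: heq_compZl.
Qed.
Lemma hcompZr c (f g : hhom n n) : hcomp f (hscale c g) = hscale c (hcomp f g).
Proof.
elim/cls_ind: f => x; elim/cls_ind: g => y; rewrite !clsE.
apply/clsP; exact: heq_compZr.
Qed.
Lemma hpart_id : hpart false (hid n) = hid n.
Proof. rewrite !clsE; apply/clsP; exact: heq_part_id. Qed.
Lemma hpart_comp p q (f g : hhom n n) :
  hpart (p (+) q) (hcomp (hpart p f) (hpart q g)) =
  hcomp (hpart p f) (hpart q g).
Proof.
elim/cls_ind: f => x; elim/cls_ind: g => y; rewrite !clsE.
apply/clsP; exact: heq_part_comp.
Qed.
HB.instance Definition _ := isSuperAlgebra.Build k (nilHecke n)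
  hcompA hcomp1l hcomp1r hcompDl hcompDr hcompZl hcompZr hpart_id hpart_comp.
End Endomorphisms.
End NilHeckeCategory.

(* Main.v *)
Require Import Defs.
From HB Require Import structures.
From mathcomp Require Import all_boot all_algebra perm zify.

(* Write P_N for the presented algebra. A morphism term f is sent to the value
   of 1 ⊗ f ⊗ 1_o in P_N, for every offset o at which it fits: a generator goes
   to the generator with the shifted index, composition to the product, and
   f ⊗ g to the product of the values of f and g at the appropriate offsets.
   This respects the axioms of monoidal supercategories because generators at
   disjoint positions supercommute in P_N, and the defining relations of the
   category because they are relations of P_N. At offset 0 it is a homomorphism
   End(I^N) -> P_N.
   Conversely, placing generators at the various positions of I^N gives a
   homomorphism P_N -> End(I^N) by the universal properties of presentations and
   of the tensor product of superalgebras. The two are inverse to each other on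
   generators. *)

Set Implicit Arguments.
Unset Strict Implicit.
Unset Printing Implicit Defensive.

Import GRing.Theory.
Local Open Scope ring_scope.

(** * Superalgebra homomorphisms and presentations *)

Section Homomorphisms.
Variable k : comPzRingType.

(** No basis or spanning set of either algebra is computed; everything is read off from generators
    and relations. The obstacle is typing: strict associativity relates terms whose types agree only
    propositionally, and a composite may pass through a number of strands different from that at its
    ends. Elements of P_N carry no source or target, so values of related terms are compared without
    casts. All generators preserve the number of strands, hence Hom(I^m, I^n) = 0 for m ≠ n; this
    settles the composites for which no bound on the offset would be available. Signs are handled by
    [scomm], a form of supercommutation stable under every operation on terms, so that disjoint
    terms supercommute as soon as disjoint generators do. Of the two composites of the
    homomorphisms, the one on P_N is checked on generators; the one on End(I^N) needs an induction
    on terms of arbitrary type and at arbitrary offset, because ⊗ changes both. *)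

Record sahom (A B : superAlgType k) (f : A -> B) : Prop := SAHom {
  sahom_lin : forall c x y, f (c *: x + y) = c *: f x + f y;
  sahom1 : f sone = sone;
  sahomM : {morph f : x y / x ** y};
  sahom_part : forall p x, f (part p x) = part p (f x)
}.

Lemma sahom_id (A : superAlgType k) : sahom (@id A).
Proof. by []. Qed.

Lemma sahom_comp (A B C : superAlgType k) (g : B -> C) (f : A -> B) :
  sahom g -> sahom f -> sahom (g \o f).
Proof.
move=> hg hf; split=> [c x y||x y|p x] /=.
- by rewrite (sahom_lin hf) (sahom_lin hg).
- by rewrite (sahom1 hf) (sahom1 hg).
- by rewrite (sahomM hf) (sahomM hg).
- by rewrite (sahom_part hf) (sahom_part hg).
Qed.

Section Theory.
Variables (A B : superAlgType k) (f : A -> B).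
Hypothesis hf : sahom f.

Lemma sahomD : {morph f : x y / x + y}.
Proof. by move=> x y; have := sahom_lin hf 1 x y; rewrite !scale1r. Qed.
Lemma sahom0 : f 0 = 0.
Proof. by apply: (addrI (f 0)); rewrite -sahomD !addr0. Qed.
Lemma sahomZ c x : f (c *: x) = c *: f x.
Proof. by rewrite -[c *: x]addr0 (sahom_lin hf) sahom0 addr0. Qed.
Lemma sahomN : {morph f : x / - x}.
Proof. by move=> x; rewrite -!scaleN1r sahomZ. Qed.
Lemma sahom_sum (I : Type) (r : seq I) (G : I -> A) :
  f (\sum_(i <- r) G i) = \sum_(i <- r) f (G i).
Proof. exact: (big_morph f sahomD sahom0). Qed.
Lemma sahom_homog p x : homog p x -> homog p (f x).
Proof. by rewrite /homog -(sahom_part hf) => ->. Qed.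
End Theory.
End Homomorphisms.

(** * Supercommuting elements *)

Section Supercommutation.
Variables (k : comPzRingType) (A : superAlgType k).
Implicit Types (x y z : A) (p q : bool).

(** Phrased through homogeneous projections so that it makes sense for inhomogeneous elements. For
    fixed [y] it is then preserved by sums, multiples, projections and products in [x], as
    inductions on terms require. *)
Definition scomm x y : Prop := forall p q,
  part p x ** part q y = (-1) ^+ (p && q) *: (part q y ** part p x).

Lemma part_homogM p q r x y : homog p x -> homog q y ->
  part r (x ** y) = if r == p (+) q then x ** y else 0.
Proof. by move=> hx hy; apply/part_homog/homogM. Qed.

Lemma part_mulE p x y :
  part p (x ** y) = part p x ** part false y + part (~~ p) x ** part true y.
Proof.
rewrite -{1}[x]part_sum -{1}[y]part_sum smulDl !smulDr !partD.
rewrite !(part_homogM _ (homog_part _ _) (homog_part _ _)).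
by case: p => /=; rewrite !(add0r, addr0) // addrC.
Qed.

Lemma scomm_homog p q x y : homog p x -> homog q y ->
  (scomm x y <-> x ** y = (-1) ^+ (p && q) *: (y ** x)).
Proof.
move=> hx hy; split=> [/(_ p q)|e p' q']; first by rewrite hx hy.
rewrite (part_homog _ hx) (part_homog _ hy).
case: eqP => [->|_]; last by rewrite smul0l smul0r scaler0.
by case: eqP => [->|_] //; rewrite smul0l smul0r scaler0.
Qed.

Lemma scomm_sym x y : scomm x y -> scomm y x.
Proof.
move=> e p q; rewrite e scalerA andbC -expr2 -exprM mulnC exprM sqrrN expr1n.
by rewrite expr1n scale1r.
Qed.

Lemma scomm_even x y : homog false x -> scomm x y -> x ** y = y ** x.
Proof.
move=> hx e; rewrite -[y]part_sum smulDl smulDr -{1 2}hx !e !hx.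
by rewrite !expr0 !scale1r.
Qed.

Lemma scomm0 y : scomm 0 y.
Proof. by move=> p q; rewrite part0 smul0l smul0r scaler0. Qed.

Lemma scomm1 y : scomm sone y.
Proof.
move=> p q; rewrite (part_homog p (part_sone : homog false (sone : A))).
by case: p => /=; rewrite ?smul0l ?smul0r ?scaler0 // smul1l smul1r scale1r.
Qed.

Lemma scomm_lin c x x' y : scomm x y -> scomm x' y -> scomm (c *: x + x') y.
Proof.
move=> e e' p q; rewrite part_linear smulDl smulDr smulZl smulZr e e'.
by rewrite scalerDr !scalerA mulrC.
Qed.

Lemma scommD x x' y : scomm x y -> scomm x' y -> scomm (x + x') y.
Proof. by move=> e /(scomm_lin 1 e); rewrite scale1r. Qed.
Lemma scommZ c x y : scomm x y -> scomm (c *: x) y.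
Proof. by move=> e; rewrite -[c *: x]addr0; apply: scomm_lin (scomm0 y). Qed.
Lemma scommN x y : scomm x y -> scomm (- x) y.
Proof. by rewrite -scaleN1r; apply: scommZ. Qed.

Lemma scomm_part p x y : scomm x y -> scomm (part p x) y.
Proof.
move=> e r q; rewrite part_part.
by case: eqP => _; rewrite ?smul0l ?smul0r ?scaler0.
Qed.

(** The part of parity [p] of [x ** x'] is a sum of two products, of parities (p, 0) and (p + 1, 1).
    In both, moving past an element of parity [q] gives the total sign (-1)^(pq). *)
Lemma scommM x x' y : scomm x y -> scomm x' y -> scomm (x ** x') y.
Proof.
move=> e e' p q; rewrite part_mulE smulDl smulDr -!smulA !e' !smulZr !smulA !e.
rewrite !smulZl !scalerA -!smulA scalerDr.
case: p; case: q => /=; rewrite ?expr0 ?expr1 ?mulr1 ?mul1r //.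
by rewrite mulrNN mulr1.
Qed.
End Supercommutation.

Lemma homog0 (k : comPzRingType) (V : superModType k) p : homog p (0 : V).
Proof. exact: part0. Qed.

Lemma even_scomm (k : comPzRingType) (B : superAlgType k) p (x y : B) :
  homog false x -> homog p y -> x ** y = y ** x -> scomm x y.
Proof. by move=> hx hy e; apply/(scomm_homog hx hy); rewrite scale1r. Qed.

Lemma sahom_scomm (k : comPzRingType) (B C : superAlgType k) (h : B -> C) x y :
  sahom h -> scomm x y -> scomm (h x) (h y).
Proof.
move=> hh e p q; rewrite -!(sahom_part hh) -!(sahomM hh) e; exact: sahomZ hh _ _.
Qed.

(** * Homomorphisms out of a presented superalgebra *)

Section PresentedSuperalgebra.
Variables (k : comPzRingType) (G : Type) (B : superAlgType k) (g : G -> B).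

Fixpoint seval (x : saterm k G) : B :=
  match x with
  | SGen a => g a
  | SZero => 0
  | SAdd x y => seval x + seval y
  | SOpp x => - seval x
  | SScale c x => c *: seval x
  | SOne => sone
  | SMul x y => seval x ** seval y
  | SPart p x => part p (seval x)
  end.

Variable R : saterm k G -> saterm k G -> Prop.
Hypothesis gR : forall x y, R x y -> seval x = seval y.

Lemma seval_eq x y : saeq R x y -> seval x = seval y.
Proof.
elim=> {x y} //=; intros; do ?congruence; do ?by auto.
- by rewrite addrA.
- by rewrite addrC.
- by rewrite add0r.
- by rewrite addNr.
- by rewrite scalerA.
- by rewrite scale1r.
- by rewrite scalerDr.
- by rewrite scalerDl.
- by rewrite part_linear.
- by rewrite part_part; case: eqP.
- by rewrite part_sum.
- by rewrite smulA.
- by rewrite smul1l.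
- by rewrite smul1r.
- by rewrite smulDl.
- by rewrite smulDr.
- by rewrite smulZl.
- by rewrite smulZr.
- by rewrite part_sone.
- by rewrite part_smul.
Qed.

(** Evaluates a chosen representative, so it is a function before the relations are verified.
    [seval_eq] makes the value independent of the choice once [gR] holds. *)
Definition pres_lift (x : presSA R) : B := seval (rep x).

Local Notation scls := (cls (saeq_equiv R)).

Lemma pres_lift_cls x : pres_lift (scls x) = seval x.
Proof. by apply: seval_eq; apply: rep_cls. Qed.

Lemma pres_lift_gen a : pres_lift (sgen R a) = g a.
Proof. exact: pres_lift_cls. Qed.

Lemma pres_lift_hom : sahom pres_lift.
Proof.
split=> [c||x y|p x].
- elim/cls_ind=> x; elim/cls_ind=> y.
  rewrite -[X in pres_lift X]/(sadd (sscale c _) _).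
  by rewrite cls_sscale cls_sadd !pres_lift_cls.
- exact: (pres_lift_cls SOne).
- elim/cls_ind: x => x; elim/cls_ind: y => y.
  by rewrite -[X in pres_lift X]/(sprod _ _) cls_sprod !pres_lift_cls.
- elim/cls_ind: x => x.
  by rewrite -[X in pres_lift X]/(spart p _) cls_spart !pres_lift_cls.
Qed.
End PresentedSuperalgebra.

Section PresentedUniqueness.
Variables (k : comPzRingType) (B : superAlgType k).

(** Every element is the class of a term built from generators, and homomorphisms preserve all
    operations of the signature, including the parity projections. *)
Lemma pres_hom_eq G (R : saterm k G -> saterm k G -> Prop) (f h : presSA R -> B) :
  sahom f -> sahom h -> (forall a, f (sgen R a) = h (sgen R a)) -> f =1 h.
Proof.
move=> hf hh e; elim/cls_ind; elim=> [a||x Hx y Hy|x Hx|c x Hx||x Hx y Hy|p x Hx].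
- exact: e.
- by rewrite [LHS](sahom0 hf) [RHS](sahom0 hh).
- by rewrite -cls_sadd [LHS](sahomD hf) [RHS](sahomD hh) Hx Hy.
- by rewrite -cls_sopp [LHS](sahomN hf) [RHS](sahomN hh) Hx.
- by rewrite -cls_sscale [LHS](sahomZ hf) [RHS](sahomZ hh) Hx.
- by rewrite [LHS](sahom1 hf) [RHS](sahom1 hh).
- by rewrite -cls_sprod [LHS](sahomM hf) [RHS](sahomM hh) Hx Hy.
- by rewrite -cls_spart [LHS](sahom_part hf) [RHS](sahom_part hh) Hx.
Qed.

(** Serves both inclusions into a free product ([j] is [inl] or [inr]) and the projection to a
    quotient ([j] is the identity). *)
Lemma sgen_hom (S : superAlgType k) G (R : saterm k G -> saterm k G -> Prop)
    (j : S -> G) :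
  (forall x y, hom_rel (fun s => SGen (j s)) x y -> R x y) ->
  sahom (fun s => sgen R (j s) : presSA R).
Proof.
move=> jR; split=> [c x y||x y|p x].
- rewrite -[RHS]/(sadd (sscale c _) _) cls_sscale cls_sadd.
  by apply/clsP/saeq_rel/jR; apply: hom_rel_linear.
- by apply/clsP/saeq_rel/jR; apply: hom_rel_one.
- rewrite -[RHS]/(sprod _ _) cls_sprod.
  by apply/clsP/saeq_rel/jR; apply: hom_rel_mul.
- rewrite -[RHS]/(spart _ _) cls_spart.
  by apply/clsP/saeq_rel/jR; apply: hom_rel_part.
Qed.

Lemma hom_rel_seval (S : superAlgType k) G (j : S -> G) (g : G -> B) x y :
  sahom (g \o j) -> hom_rel (fun s => SGen (j s)) x y -> seval g x = seval g y.
Proof.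
move=> h [c {}x {}y||{}x {}y|p {}x] /=.
- exact: (sahom_lin h).
- exact: (sahom1 h).
- exact: (sahomM h).
- exact: (sahom_part h).
Qed.
End PresentedUniqueness.

(** * Universal properties of free superalgebras, free products and quotients *)

Section UniversalProperties.
Variable k : comPzRingType.

Section Free.
Variables (G : Type) (par : G -> bool) (B : superAlgType k) (g : G -> B).
Hypothesis hg : forall a, homog (par a) (g a).

Lemma free_gen_homog a : homog (par a) (free_gen k par a).
Proof.
by rewrite /homog -[LHS]/(spart _ _) cls_spart; apply/clsP/saeq_rel.
Qed.

Lemma free_lift_subproof x y : free_rel par x y -> seval g x = seval g y.
Proof. by case=> a; apply: hg. Qed.

Definition free_lift : freeSA k par -> B := @pres_lift k G B g (free_rel par).
Lemma free_lift_hom : sahom free_lift.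
Proof. exact: pres_lift_hom free_lift_subproof. Qed.
Lemma free_lift_gen a : free_lift (free_gen k par a) = g a.
Proof. exact: pres_lift_gen free_lift_subproof _. Qed.
End Free.

Section Product.
Variables (S T B : superAlgType k) (f : S -> B) (h : T -> B).
Hypotheses (hf : sahom f) (hh : sahom h).

Lemma fp_inl_hom : sahom (@fp_inl k S T).
Proof. by apply: (sgen_hom (j := inl)) => x y; apply: fprod_rel_l. Qed.
Lemma fp_inr_hom : sahom (@fp_inr k S T).
Proof. by apply: (sgen_hom (j := inr)) => x y; apply: fprod_rel_r. Qed.

Let g (z : S + T) := match z with inl s => f s | inr t => h t end.

Lemma fprod_lift_subproof x y : fprod_rel x y -> seval g x = seval g y.
Proof.
case=> {x y} x y; first exact: (hom_rel_seval (j := inl)).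
exact: (hom_rel_seval (j := inr)).
Qed.

Definition fprod_lift : freeProd S T -> B := @pres_lift k _ B g (@fprod_rel k S T).
Lemma fprod_lift_hom : sahom fprod_lift.
Proof. exact: pres_lift_hom fprod_lift_subproof. Qed.
Lemma fprod_lift_l s : fprod_lift (fp_inl T s) = f s.
Proof. exact: pres_lift_gen fprod_lift_subproof _. Qed.
Lemma fprod_lift_r t : fprod_lift (fp_inr S t) = h t.
Proof. exact: pres_lift_gen fprod_lift_subproof _. Qed.
End Product.

Section Quotient.
Variables (S B : superAlgType k) (R : S -> S -> Prop) (f : S -> B).
Hypotheses (hf : sahom f) (fR : forall x y, R x y -> f x = f y).

Lemma quot_proj_hom : sahom (quot_proj R).
Proof. by apply: (sgen_hom (j := id)) => x y; apply: quot_rel_hom. Qed.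
Lemma quot_proj_rel x y : R x y -> quot_proj R x = quot_proj R y.
Proof. by move=> r; apply/clsP/saeq_rel/quot_rel_rel. Qed.

Lemma quot_lift_subproof x y : quot_rel R x y -> seval f x = seval f y.
Proof.
case=> {x y} [x y|x y /fR //]; exact: (hom_rel_seval (j := id)).
Qed.

Definition quot_lift : quotSA R -> B := @pres_lift k _ B f (quot_rel R).
Lemma quot_lift_hom : sahom quot_lift.
Proof. exact: pres_lift_hom quot_lift_subproof. Qed.
Lemma quot_lift_proj s : quot_lift (quot_proj R s) = f s.
Proof. exact: pres_lift_gen quot_lift_subproof _. Qed.
End Quotient.
End UniversalProperties.

(** * The universal property of the tensor power *)

Section OrderedProducts.
Variables (k : comPzRingType) (B : superAlgType k).
Implicit Types (b c : nat -> B) (m : nat).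

(* b (m - 1) ** ... ** b 0 : tensor factors are numbered from right to left. *)
Fixpoint ordprod b m : B := if m is m'.+1 then b m' ** ordprod b m' else sone.

Lemma eq_ordprod b c m : (forall j, (j < m)%N -> b j = c j) ->
  ordprod b m = ordprod c m.
Proof.
elim: m => //= m IH e; rewrite e // IH // => j jm.
by apply: e; apply: ltnW.
Qed.

Lemma ordprod_scomm b m y : (forall j, (j < m)%N -> scomm (b j) y) ->
  scomm (ordprod b m) y.
Proof.
elim: m => [|m IH] e /=; first exact: scomm1.
by apply: scommM; [apply: e | apply: IH => j /ltnW; apply: e].
Qed.

Lemma ordprod_homog b (p : nat -> bool) m :
  (forall j, (j < m)%N -> homog (p j) (b j)) ->
  homog (\big[addb/false]_(j < m) p j) (ordprod b m).
Proof.
elim: m => [|m IH] e; first by rewrite big_ord0; apply: part_sone.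
rewrite big_ord_recr /= addbC; apply: homogM; first exact: e.
by apply: IH => j /ltnW; apply: e.
Qed.

Lemma signr_addb (I : Type) (r : seq I) (p : I -> bool) (q : bool) :
  (-1) ^+ (\big[addb/false]_(i <- r) p i && q) =
  \prod_(i <- r) (-1) ^+ (p i && q) :> k.
Proof.
rewrite (big_morph (fun x => x && q) (fun x y => andb_addl x y q) (erefl _)).
exact: (big_morph (fun x : bool => (-1) ^+ x : k) (@signrb k) (erefl _)).
Qed.

(** To reach [b m], the top factor [c m] passes all of [b (m - 1)], ..., [b 0]; this gives the sign
    factors with [i = m], and induction gives the others. The double product is [ksign] with
    positions in [nat]. *)
Lemma ordprodM b c (p q : nat -> bool) m :
  (forall j, (j < m)%N -> homog (p j) (b j)) ->
  (forall j, (j < m)%N -> homog (q j) (c j)) ->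
  (forall i j, (j < i < m)%N -> scomm (b j) (c i)) ->
  ordprod b m ** ordprod c m =
  (\prod_(i < m) \prod_(j < i) (-1) ^+ (p j && q i)) *:
     ordprod (fun j => b j ** c j) m.
Proof.
elim: m => [|m IH] hb hc bc; first by rewrite big_ord0 scale1r smul1l.
have hb' j : (j < m)%N -> homog (p j) (b j) by move/ltnW; apply: hb.
have hc' j : (j < m)%N -> homog (q j) (c j) by move/ltnW; apply: hc.
rewrite /= -smulA (smulA _ (c m)).
have : scomm (ordprod b m) (c m).
  by apply: ordprod_scomm => j jm; apply: bc; rewrite jm ltnSn.
move/(scomm_homog (ordprod_homog hb') (hc m (ltnSn m))) => ->.
rewrite signr_addb smulZl -smulA IH //; last first.
  by move=> i j /andP[ji im]; apply: bc; rewrite ji ltnW.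
by rewrite !smulZr scalerA smulA big_ord_recr /= mulrC.
Qed.
End OrderedProducts.

Lemma sahom_ordprod (k : comPzRingType) (B C : superAlgType k) (f : B -> C) b m :
  sahom f -> f (ordprod b m) = ordprod (f \o b) m.
Proof.
by move=> hf; elim: m => [|m IH] /=; rewrite ?(sahom1 hf) ?(sahomM hf) ?IH.
Qed.

(** Turns positions into natural numbers, so that shifts such as [i.+1] and comparisons of offsets
    are plain arithmetic; [x0] is the value out of range. *)
Definition ext (T : Type) (x0 : T) n (f : 'I_n -> T) (j : nat) : T :=
  if insub j is Some i then f i else x0.

Lemma ext_lt (T : Type) (x0 : T) n (f : 'I_n -> T) j (h : (j < n)%N) :
  ext x0 f j = f (Ordinal h).
Proof. by rewrite /ext insubT. Qed.

Lemma ext_ord (T : Type) (x0 : T) n (f : 'I_n -> T) (i : 'I_n) :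
  ext x0 f i = f i.
Proof. by rewrite ext_lt; congr f; apply: val_inj. Qed.

Section TensorUniversal.
Variables (k : comPzRingType) (A B : superAlgType k) (n : nat).
Variable T : nat -> A -> B.
Hypothesis hT : forall j, (j < n)%N -> sahom (T j).
Hypothesis cT : forall i j a b, (i < j < n)%N -> scomm (T i a) (T j b).

Definition tprod (f : {ffun 'I_n -> A}) : B :=
  ordprod (fun j => T j (ext sone f j)) n.

(** By induction on partial products: those up to position [i] do not see the change, the factor at
    [i] is linear because [T i] is, and the later factors only multiply on the left. *)
Lemma tprod_multilinear : multilinear tprod.
Proof.
move=> f i c x y; rewrite /tprod.
have eu z j (h : (j < n)%N) :
    ext sone (upd f i z) j = if j == i :> nat then z else ext sone f j.
  by rewrite !(ext_lt _ _ h) ffunE.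
have low z m : (m <= i)%N -> ordprod (fun j => T j (ext sone (upd f i z) j)) m =
    ordprod (fun j => T j (ext sone f j)) m.
  move=> mi; apply: eq_ordprod => j jm.
  by rewrite eu ?ifN //; have := ltn_ord i; lia.
suff H m : (i < m <= n)%N ->
    ordprod (fun j => T j (ext sone (upd f i (c *: x + y)) j)) m =
    c *: ordprod (fun j => T j (ext sone (upd f i x) j)) m +
    ordprod (fun j => T j (ext sone (upd f i y) j)) m.
  by apply: H; rewrite ltn_ord leqnn.
elim: m => // m IH /andP[im mn] /=; rewrite !eu //.
have [e|ne] := eqVneq m i.
  by rewrite !low ?e // (sahom_lin (hT (ltn_ord i))) smulDl smulZl.
rewrite IH ?smulDr ?smulZr //; lia.
Qed.

Definition tensor_lift (x : tens A n) : B := tlift tprod x.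

Lemma tensor_lift_pure f : tensor_lift (pure f) = tprod f.
Proof. exact: tlift_pure tprod_multilinear. Qed.

Lemma tensor_lift_linear c x y :
  tensor_lift (c *: x + y) = c *: tensor_lift x + tensor_lift y.
Proof. exact: tlift_linear tprod_multilinear. Qed.

Lemma tensor_lift0 : tensor_lift 0 = 0.
Proof. exact: tlift0 tprod_multilinear. Qed.

Lemma tensor_liftZ c x : tensor_lift (c *: x) = c *: tensor_lift x.
Proof. by rewrite -[c *: x]addr0 tensor_lift_linear tensor_lift0 addr0. Qed.

Lemma ext_homog p (f : {ffun 'I_n -> A}) j : homogs p f -> (j < n)%N ->
  homog (ext false p j) (T j (ext sone f j)).
Proof.
move=> hf h; rewrite !(ext_lt _ _ h).
by apply: (sahom_homog (hT h)); apply: hf.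
Qed.

Lemma tprod_homog p f : homogs p f ->
  homog (\big[addb/false]_i p i) (tprod f).
Proof.
move=> hf; rewrite -(eq_bigr _ (fun i _ => ext_ord false p i)).
by apply: ordprod_homog => j; apply: ext_homog.
Qed.

Lemma tensor_lift_hom : sahom tensor_lift.
Proof.
split.
- exact: tensor_lift_linear.
- rewrite [LHS]tensor_lift_pure /tprod.
  have: forall m, (m <= n)%N ->
      ordprod (fun j => T j (ext sone [ffun _ : 'I_n => (sone : A)] j)) m = sone.
    elim=> // m IH mn /=.
    by rewrite IH ?(ltnW mn) // ext_lt ffunE (sahom1 (hT mn)) smul1l.
  exact.
- move=> x y; elim/tens_homog_ind: x => [|c u v Hu Hv|p a ha].
  + by rewrite smul0l tensor_lift0 smul0l.
  + by rewrite smulDl smulZl !tensor_lift_linear Hu Hv smulDl smulZl.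
  elim/tens_homog_ind: y => [|c u v Hu Hv|q b hb].
  + by rewrite smul0r tensor_lift0 smul0r.
  + by rewrite smulDr smulZr !tensor_lift_linear Hu Hv smulDr smulZr.
  rewrite [X in tensor_lift X](tmul_homog ha hb) tensor_liftZ !tensor_lift_pure.
  rewrite /tprod (ordprodM (p := ext false p) (q := ext false q)).
  + congr (_ *: _).
      apply: eq_bigr => i _.
      have e j (ji : (j < i)%N) : (j < n)%N by apply: ltn_trans ji _.
      rewrite ext_ord.
      (* [ordprodM] has an inner product over [j < i], [ksign] one over all of ['I_n] with the
         condition [j < i]. *)
      rewrite (big_ord_widen n (fun j => (-1) ^+ (ext false p j && q i))) 1?ltnW //.
      by apply: eq_bigr => j _; rewrite ext_ord.
    by apply: eq_ordprod => j jn; rewrite !(ext_lt _ _ jn) ffunE (sahomM (hT jn)).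
  + by move=> j; apply: ext_homog.
  + by move=> j; apply: ext_homog.
  + by move=> i j ji; apply: cT.
- move=> p x; elim/tens_homog_ind: x => [|c u v Hu Hv|q a ha].
  + by rewrite part0 tensor_lift0 part0.
  + by rewrite part_linear !tensor_lift_linear part_linear Hu Hv.
  rewrite [X in tensor_lift X](tpart_homog _ ha) tensor_lift_pure.
  rewrite (part_homog _ (tprod_homog ha)); case: eqP => _ //.
    by rewrite tensor_lift_pure.
  exact: tensor_lift0.
Qed.

Lemma tensor_lift_scomm y x :
  (forall j a, (j < n)%N -> scomm (T j a) y) -> scomm (tensor_lift x) y.
Proof.
move=> e; elim/tens_ind: x => [|c u v Hu Hv|f].
- by rewrite tensor_lift0; apply: scomm0.
- by rewrite tensor_lift_linear; apply: scomm_lin.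
- by rewrite tensor_lift_pure; apply: ordprod_scomm => j; apply: e.
Qed.

(** Here [v] abstracts a crossing: it exchanges the tokens at [i] and [i.+1] and supercommutes with
    the others. This is what the relation u_i a = s_i(a) u_i asks of the images of its
    generators. *)
Lemma tensor_lift_swap (i : 'I_n.-1) (v : B) x : homog false v ->
  (forall a, v ** T i.+1 a = T i a ** v) ->
  (forall a, v ** T i a = T i.+1 a ** v) ->
  (forall j a, (j < n)%N -> j != i -> j != i.+1 -> scomm v (T j a)) ->
  v ** tensor_lift x = tensor_lift (tswap i x) ** v.
Proof.
move=> hv vhi vlo vT.
have lin := @tlift_linear k A n _ _ _ _ _ (tswap_pureM i).
elim/tens_homog_ind: x => [|c u w Hu Hw|p f hf].
- by rewrite /tswap tlift0 ?tensor_lift0 ?smul0l ?smul0r //; apply: tswap_pureM.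
- by rewrite [tswap i _]lin !tensor_lift_linear smulDr smulZr Hu Hw smulDl smulZl.
rewrite (tswap_homog i hf) tensor_liftZ !tensor_lift_pure /tprod smulZl.
set g := finfun _.
have hin : (i.+1 < n)%N := ltn_ord (hi i).
have ilo : ext sone f i = f (lo i) by rewrite -(ext_ord sone f (lo i)).
have ihi : ext sone f i.+1 = f (hi i) by rewrite -(ext_ord sone f (hi i)).
have glo : ext sone g i = f (hi i).
  by rewrite -[X in ext _ _ X]/(val (lo i)) ext_ord ffunE tpermL.
have ghi : ext sone g i.+1 = f (lo i).
  by rewrite -[X in ext _ _ X]/(val (hi i)) ext_ord ffunE tpermR.
have gne j : (j < n)%N -> j != i -> j != i.+1 -> ext sone g j = ext sone f j.
  move=> h n1 n2; rewrite !(ext_lt _ _ h) ffunE tpermD //.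
    by rewrite -val_eqE /= eq_sym.
  by rewrite -val_eqE /= eq_sym.
have low m : (m <= i)%N ->
    ordprod (fun j => T j (ext sone g j)) m = ordprod (fun j => T j (ext sone f j)) m.
  move=> mi; apply: eq_ordprod => j jm.
  by rewrite gne //; lia.
have vlow : v ** ordprod (fun j => T j (ext sone f j)) i =
    ordprod (fun j => T j (ext sone f j)) i ** v.
  apply: scomm_even => //; apply: scomm_sym; apply: ordprod_scomm => j ji.
  by apply: scomm_sym; apply: vT; lia.
suff H m : (i.+1 < m <= n)%N ->
   v ** ordprod (fun j => T j (ext sone f j)) m = (-1) ^+ (p (lo i) && p (hi i)) *:
      (ordprod (fun j => T j (ext sone g j)) m ** v).
  by apply: H; rewrite leqnn andbT.
elim: m => // m IH /andP[im mn] /=.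
(* The induction starts when both exchanged factors are present. Passing [v] through them leaves
   them in the wrong order; restoring the order by supercommutation produces exactly the sign of
   [tswap]. *)
have [e|ne] := eqVneq m i.+1.
  subst m; rewrite /= low // ghi glo ihi ilo.
  rewrite -[in RHS]smulA -[in RHS]smulA -vlow 2!smulA vhi -(smulA (T i _)) vlo.
  have hlo := sahom_homog (hT (ltn_ord (lo i))) (hf (hi i)).
  have hhi := sahom_homog (hT hin) (hf (lo i)).
  have ci : scomm (T i (f (hi i))) (T i.+1 (f (lo i))).
    by apply: cT; rewrite ltnSn.
  rewrite smulA.
  move/(scomm_homog hlo hhi): ci => ->.
  by rewrite !smulZl andbC -!smulA.
rewrite smulA (scomm_even hv); last by apply: vT; lia.
by rewrite gne -?smulA ?IH ?smulZr ?smulA //; lia.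
Qed.
End TensorUniversal.

(** * Tensors with one distinguished factor *)

Section Tokens.
Variables (k : comPzRingType) (A : superAlgType k) (n : nat).
Implicit Types (a b : A) (p q : bool) (i j : nat).

(** For [j >= n] this is the unit tensor whatever [a] is, whence the bounds [j < n] in the linearity
    statements. *)
Definition tok j a : tens A n := pure [ffun i : 'I_n => if i == j :> nat then a else sone].
Definition tokpar j p : {ffun 'I_n -> bool} := [ffun i : 'I_n => (i == j :> nat) && p].

Lemma tok_homogs j p a : homog p a ->
  homogs (tokpar j p) [ffun i : 'I_n => if i == j :> nat then a else sone].
Proof. by move=> ha i; rewrite !ffunE; case: eqP => // _; apply: part_sone. Qed.

Lemma ksign1 (p q : {ffun 'I_n -> bool}) :
  (forall i j : 'I_n, (j < i)%N -> p j && q i = false) -> ksign k p q = 1.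
Proof.
by move=> e; rewrite /ksign big1 // => i _; rewrite big1 // => j ji; rewrite e.
Qed.

Lemma tok_linear j c a b : (j < n)%N -> tok j (c *: a + b) = c *: tok j a + tok j b.
Proof.
move=> jn; pose one : {ffun 'I_n -> A} := [ffun=> sone].
have E x : tok j x = pure (upd one (Ordinal jn) x).
  by congr pure; apply/ffunP => i; rewrite !ffunE.
by rewrite !E pure_multilinear.
Qed.

Lemma tok_homog j p a : (j < n)%N -> homog p a -> homog p (tok j a).
Proof.
move=> jn ha; rewrite /homog [LHS](tpart_homog _ (tok_homogs j ha)) ifT //.
rewrite (bigD1 (Ordinal jn)) //= big1 => [|i]; first by rewrite ffunE eqxx addbF.
by rewrite -val_eqE /= ffunE => /negPf->.
Qed.

Lemma tok_hom j : (j < n)%N -> sahom (tok j).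
Proof.
move=> jn; have L := fun c a b => @tok_linear j c a b jn.
have D a b : tok j (a + b) = tok j a + tok j b.
  by rewrite -[a]scale1r L !scale1r.
split=> // [|x y|p x].
- by rewrite -[RHS]/(tone A n); congr pure; apply/ffunP => i; rewrite !ffunE if_same.
- suff M p q a b : homog p a -> homog q b -> tok j (a ** b) = tok j a ** tok j b.
    rewrite -[x]part_sum -[y]part_sum !(smulDl, smulDr) !D !(smulDl, smulDr).
    by congr (_ + _ + (_ + _)); apply: M; apply: homog_part.
  move=> ha hb; rewrite [RHS](tmul_homog (tok_homogs j ha) (tok_homogs j hb)).
  rewrite ksign1 ?scale1r.
    by congr pure; apply/ffunP => i; rewrite !ffunE; case: eqP; rewrite ?smul1l.
  by move=> i l li; rewrite !ffunE; apply/negbTE; lia.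
- rewrite -{2}[x]part_sum D partD.
  rewrite !(part_homog p (tok_homog jn (homog_part _ x))).
  by case: p; rewrite ?add0r ?addr0.
Qed.

Lemma tok_scomm i j a b : (i < j < n)%N -> scomm (tok i a) (tok j b).
Proof.
move=> /andP[ij jn]; have ni := ltn_trans ij jn.
move=> p q; rewrite -(sahom_part (tok_hom ni)) -(sahom_part (tok_hom jn)).
have ha := tok_homogs i (homog_part p a); have hb := tok_homogs j (homog_part q b).
rewrite [LHS](tmul_homog ha hb) [X in _ = _ *: X](tmul_homog hb ha).
(* With [i < j], the product [tok j b ** tok i a] is already in tensor order and has no sign. In the
   other product only the pair of positions [j], [i] contributes. *)
rewrite (ksign1 (p := tokpar j q)) => [|u v vu]; last first.
  by rewrite !ffunE; apply/negbTE; lia.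
rewrite scale1r /ksign (bigD1 (Ordinal jn)) //= [X in _ * X]big1 => [|u]; last first.
  by rewrite -val_eqE /= => ne; apply: big1 => v _; rewrite !ffunE (negPf ne) andbF.
rewrite (bigD1 (Ordinal ni)) //= big1 => [|v /andP[_]]; last first.
  by rewrite -val_eqE /= => ne; rewrite !ffunE (negPf ne).
rewrite !ffunE !eqxx !mulr1; congr (_ *: pure _).
apply/ffunP => u; rewrite !ffunE.
have [->|] := eqVneq (u : nat) i; last by rewrite smul1l smul1r.
by rewrite ifN ?smul1l ?smul1r //; lia.
Qed.

(** Tokens at single positions generate the tensor power, and no sign arises because the factors are
    multiplied in tensor order. *)
Lemma tprod_tok (f : {ffun 'I_n -> A}) : tprod tok f = pure f.
Proof.
have ht j (jn : (j < n)%N) := tok_hom jn.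
(* [tmul_homog] computes products of homogeneous tensors only. In terms of [tensor_lift] both sides
   are linear in [x], which allows the reduction to homogeneous pure tensors. *)
suff {f} H x : tensor_lift tok x = x by rewrite -(tensor_lift_pure ht) H.
elim/tens_homog_ind: x => [|c u v Hu Hv|p f hf].
- exact: tensor_lift0.
- by rewrite tensor_lift_linear // Hu Hv.
rewrite tensor_lift_pure //.
pose g m : {ffun 'I_n -> A} := [ffun l : 'I_n => if (l < m)%N then f l else sone].
have hg m : homogs [ffun l : 'I_n => (l < m)%N && p l] (g m).
  by move=> l; rewrite !ffunE; case: ltnP => _ /=; [apply: hf | apply: part_sone].
suff H m : (m <= n)%N -> ordprod (fun j => tok j (ext sone f j)) m = pure (g m).
  by rewrite [LHS]H //; congr pure; apply/ffunP => l; rewrite ffunE ltn_ord.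
elim: m => [|m IH] mn /=.
  by rewrite -[LHS]/(tone A n); congr pure; apply/ffunP => l; rewrite !ffunE.
rewrite IH ?(ltnW mn) // (ext_lt _ _ mn).
rewrite [LHS](tmul_homog (tok_homogs m (hf (Ordinal mn))) (hg m)).
rewrite ksign1 => [|u v vu]; last by rewrite !ffunE; apply/negbTE; lia.
rewrite scale1r; congr pure; apply/ffunP => l; rewrite !ffunE ltnS [in RHS]leq_eqVlt.
case: eqP => [e|_]; last by rewrite smul1l.
by rewrite e ltnn smul1r; congr (f _); apply: val_inj.
Qed.

(** Deduced from [tprod_tok], hence valid without any parity assumption. It is applied to the
    summands of [tau], where [symFrobenius] records parities for the basis but not for the dual
    basis. *)
Lemma tok_mul i j a b : (j < i < n)%N ->
  tok i a ** tok j b =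
  pure [ffun l : 'I_n => if l == i :> nat then a
                         else if l == j :> nat then b else sone].
Proof.
move=> /andP[ji ni]; rewrite -tprod_tok /tprod.
set f := finfun _; have fE l (ln : (l < n)%N) : ext sone f l =
    if l == i then a else if l == j then b else sone.
  by rewrite ext_lt ffunE.
have H m : (m <= n)%N -> ordprod (fun j => tok j (ext sone f j)) m =
    if (i < m)%N then tok i a ** tok j b else if (j < m)%N then tok j b else sone.
  elim: m => // m IH mn /=; rewrite IH ?(ltnW mn) // fE //.
  have [->|ni'] := eqVneq m i; first by rewrite ltnn ltnSn ji.
  have [->|nj] := eqVneq m j.
    by rewrite ltnn ltnSn !(@ifN _ (i < _)%N) ?smul1r //; lia.
  rewrite (sahom1 (tok_hom mn)) smul1l !ltnS.
  by rewrite (leq_eqVlt i) (leq_eqVlt j) !(eq_sym _ m) (negPf ni') (negPf nj).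
by rewrite H // ni.
Qed.
End Tokens.

Lemma tensor_lift_tok (k : comPzRingType) (A B : superAlgType k) n
    (T : nat -> A -> B) j a :
  (forall j, (j < n)%N -> sahom (T j)) -> (j < n)%N ->
  tensor_lift T (tok n j a) = T j a.
Proof.
move=> hT jn; rewrite tensor_lift_pure //.
suff H m : (m <= n)%N -> ordprod (fun l => T l (ext sone
    [ffun i : 'I_n => if i == j :> nat then a else sone] l)) m =
    if (j < m)%N then T j a else sone.
  by rewrite [LHS]H // jn.
elim: m => // m IH mn /=; rewrite IH ?(ltnW mn) // (ext_lt _ _ mn) ffunE /=.
have [->|ne] := eqVneq m j; first by rewrite ltnn ltnSn smul1r.
by rewrite (sahom1 (hT m mn)) smul1l ltnS [in RHS]leq_eqVlt eq_sym (negPf ne).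
Qed.

(** * Generators and relations of the presented algebra *)

Section PresentedGenerators.
Variables (k : comPzRingType) (A : superAlgType k) (eps : bool).
Variables (F : symFrobenius A eps) (n : nat).
Local Notation P := (nilHeckePres F n).

Definition nilCox_to_pres (x : nilCox A n) : P :=
  quot_proj (@nilHecke_rel k A eps F n) (fp_inl _ x).
Definition tens_to_pres (a : tens A n) : P := nilCox_to_pres (nilCox_A a).
Definition free_to_pres (x : freeSA k (fun _ : 'I_n => eps)) : P :=
  quot_proj (@nilHecke_rel k A eps F n) (fp_inr _ x).

Lemma nilCox_to_pres_hom : sahom nilCox_to_pres.
Proof. exact: sahom_comp (quot_proj_hom _) (fp_inl_hom _ _). Qed.
Lemma free_to_pres_hom : sahom free_to_pres.
Proof. exact: sahom_comp (quot_proj_hom _) (fp_inr_hom _ _). Qed.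
Lemma nilCox_A_hom : sahom (@nilCox_A k A n).
Proof. exact: sahom_comp (quot_proj_hom _) (fp_inl_hom _ _). Qed.
Lemma tens_to_pres_hom : sahom tens_to_pres.
Proof. exact: sahom_comp nilCox_to_pres_hom nilCox_A_hom. Qed.

(** The value 0 out of range is homogeneous of both parities and satisfies the relations u^2 = 0 and
    u_i u_j = u_j u_i, so the corresponding lemmas carry no bounds. *)
Definition pres_u (j : nat) : P := ext 0 (fun i => nilCox_to_pres (nilCox_u A i)) j.
Definition pres_x (j : nat) : P := ext 0 (fun i => free_to_pres (free_gen k _ i)) j.
Definition pres_tok (j : nat) (a : A) : P := tens_to_pres (tok n j a).

Lemma pres_uE (i : 'I_n.-1) : pres_u i = nilCox_to_pres (nilCox_u A i).
Proof. exact: ext_ord. Qed.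
Lemma pres_xE (i : 'I_n) : pres_x i = free_to_pres (free_gen k _ i).
Proof. exact: ext_ord. Qed.

Lemma pres_u_even j : homog false (pres_u j).
Proof.
rewrite /pres_u /ext; case: insub => [i|]; last exact: homog0.
apply: (sahom_homog nilCox_to_pres_hom).
apply: (sahom_homog (sahom_comp (quot_proj_hom _) (fp_inr_hom _ _))).
exact: free_gen_homog.
Qed.

Lemma pres_x_homog j : homog eps (pres_x j).
Proof.
rewrite /pres_x /ext; case: insub => [i|]; last exact: homog0.
apply: (sahom_homog free_to_pres_hom).
exact: (@free_gen_homog k _ (fun=> eps) i).
Qed.

Lemma pres_tok_hom j : (j < n)%N -> sahom (pres_tok j).
Proof. by move=> jn; apply: sahom_comp tens_to_pres_hom (tok_hom A jn). Qed.

Lemma pres_tok_scomm i j a b : (i < n)%N -> (j < n)%N -> i != j ->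
  scomm (pres_tok i a) (pres_tok j b).
Proof.
move=> ni nj ne; wlog ij : i j a b ni nj ne / (i < j)%N => [H|].
  have := ne; rewrite neq_ltn => /orP[|ji]; first exact: H.
  by apply: scomm_sym; apply: H; rewrite // eq_sym.
have := @tok_scomm k A n i j a b; rewrite ij nj => /(_ isT) e p q.
have := e p q => /(congr1 tens_to_pres).
by rewrite (sahomZ tens_to_pres_hom) !(sahomM tens_to_pres_hom) !(sahom_part tens_to_pres_hom).
Qed.

Let coxrel x y (r : @nilCox_rel k A n x y) :
  nilCox_to_pres (quot_proj _ x) = nilCox_to_pres (quot_proj _ y).
Proof. by rewrite (quot_proj_rel r). Qed.

Let coxM x y : nilCox_to_pres (quot_proj (@nilCox_rel k A n) (x ** y)) =
  nilCox_to_pres (quot_proj _ x) ** nilCox_to_pres (quot_proj _ y).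
Proof. by rewrite (sahomM (quot_proj_hom _)) (sahomM nilCox_to_pres_hom). Qed.

Lemma pres_u_sq j : pres_u j ** pres_u j = 0.
Proof.
rewrite /pres_u /ext; case: insub => [i|]; last exact: smul0l.
rewrite -coxM (coxrel (nilCox_sq A i)).
by rewrite (sahom0 (quot_proj_hom _)) (sahom0 nilCox_to_pres_hom).
Qed.

Lemma pres_u_far i j : (i.+1 < j)%N || (j.+1 < i)%N ->
  pres_u i ** pres_u j = pres_u j ** pres_u i.
Proof.
rewrite /pres_u /ext; case: insubP => [i' _ ei|]; last by rewrite smul0l smul0r.
case: insubP => [j' _ ej|]; last by rewrite smul0l smul0r.
by rewrite -ei -ej => ij; rewrite -!coxM (coxrel (nilCox_far A ij)).
Qed.

Lemma pres_u_braid i : (i.+2 < n)%N ->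
  pres_u i ** pres_u i.+1 ** pres_u i = pres_u i.+1 ** pres_u i ** pres_u i.+1.
Proof.
move=> h; have h1 : (i < n.-1)%N by lia.
have h2 : (i.+1 < n.-1)%N by lia.
rewrite /pres_u !(ext_lt _ _ h1) !(ext_lt _ _ h2).
rewrite -!coxM; apply: coxrel; exact: nilCox_braid.
Qed.

Lemma pres_u_tens (i : 'I_n.-1) a :
  pres_u i ** tens_to_pres a = tens_to_pres (tswap i a) ** pres_u i.
Proof.
rewrite pres_uE [LHS]/(nilCox_to_pres (quot_proj _ _) ** nilCox_to_pres (quot_proj _ _)).
rewrite -[LHS]coxM (coxrel (nilCox_swap i a)); exact: coxM.
Qed.

Lemma tswap_linear (i : 'I_n.-1) c (x y : tens A n) :
  tswap i (c *: x + y) = c *: tswap i x + tswap i y.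
Proof. exact: tlift_linear (tswap_pureM i). Qed.

Implicit Types a b : A.

Lemma tswap_tok (i : 'I_n.-1) j j' a : (j < n)%N -> (j' < n)%N ->
  (forall l : 'I_n, (tperm (lo i) (hi i) l == j :> nat) = (l == j' :> nat)) ->
  tswap i (tok n j a) = tok n j' a.
Proof.
move=> jn jn' e.
suff H p b : homog p b -> tswap i (tok n j b) = tok n j' b.
  rewrite -[a]part_sum -[part false a]scale1r !tok_linear // tswap_linear.
  by rewrite !(H _ _ (homog_part _ _)).
move=> hb; rewrite (tswap_homog i (tok_homogs j hb)) !ffunE /=.
(* At most one of the two exchanged factors differs from 1, so the swap has trivial sign. *)
have -> : ((i == j :> nat) && p) && ((i.+1 == j) && p) = false by lia.
by rewrite scale1r; congr pure; apply/ffunP => l; rewrite !ffunE e.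
Qed.

Lemma tperm_val (i : 'I_n.-1) (l : 'I_n) : tperm (lo i) (hi i) l =
  (if l == i :> nat then i.+1 else if l == i.+1 :> nat then nat_of_ord i else l) :> nat.
Proof.
case: tpermP => [->|->|/eqP nlo /eqP nhi] /=; first by rewrite eqxx.
  by rewrite eqxx ifN //; lia.
by rewrite !ifN.
Qed.

Lemma pres_u_pres_tok_lo j a : (j.+1 < n)%N ->
  pres_u j ** pres_tok j a = pres_tok j.+1 a ** pres_u j.
Proof.
move=> h; have h1 : (j < n.-1)%N by lia.
have := pres_u_tens (Ordinal h1) (tok n j a).
rewrite (@tswap_tok _ _ j.+1) //; try lia.
by move=> l; rewrite tperm_val /=; do ?case: ifP; lia.
Qed.

Lemma pres_u_pres_tok_hi j a : (j.+1 < n)%N ->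
  pres_u j ** pres_tok j.+1 a = pres_tok j a ** pres_u j.
Proof.
move=> h; have h1 : (j < n.-1)%N by lia.
have := pres_u_tens (Ordinal h1) (tok n j.+1 a).
rewrite (@tswap_tok _ _ j) //; try lia.
by move=> l; rewrite tperm_val /=; do ?case: ifP; lia.
Qed.

Lemma pres_u_pres_tok_far i j a : (j < n)%N -> j != i -> j != i.+1 ->
  scomm (pres_u i) (pres_tok j a).
Proof.
move=> h ji ji'; suff H p b : homog p b -> scomm (pres_u i) (pres_tok j b).
  rewrite -[a]part_sum (sahomD (pres_tok_hom h)); apply/scomm_sym/scommD; apply: scomm_sym;
  exact: H (homog_part _ _).
move=> hb; apply: (even_scomm (pres_u_even i) (sahom_homog (pres_tok_hom h) hb)).
have [h1|h1] := ltnP i n.-1; last by rewrite /pres_u /ext insubN -?leqNgt // smul0l smul0r.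
have := pres_u_tens (Ordinal h1) (tok n j b).
rewrite (@tswap_tok _ _ j) //.
by move=> l; rewrite tperm_val /=; do ?case: ifP; lia.
Qed.

Let R := @nilHecke_rel k A eps F n.
Let prel x y (r : R x y) : quot_proj R x = quot_proj R y := quot_proj_rel r.
Let pM := sahomM (quot_proj_hom R).
Let pD := sahomD (quot_proj_hom R).
Let pZ := sahomZ (quot_proj_hom R).

Lemma pres_x_pres_x i j : (i < n)%N -> (j < n)%N -> i != j -> scomm (pres_x i) (pres_x j).
Proof.
move=> hi hj ne; apply/(scomm_homog (pres_x_homog i) (pres_x_homog j)).
rewrite /pres_x !(ext_lt _ _ hi) !(ext_lt _ _ hj) /free_to_pres -!pM -pZ andbb.
exact/prel/nilHecke_xx.
Qed.

Lemma tens_pres_x x j : (j < n)%N -> scomm (tens_to_pres x) (pres_x j).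
Proof.
move=> hj; suff H p (b : tens A n) : homog p b -> scomm (tens_to_pres b) (pres_x j).
  rewrite -[x]part_sum (sahomD tens_to_pres_hom).
  by apply: scommD; apply: H (homog_part _ _).
move=> hb; apply/(scomm_homog (sahom_homog tens_to_pres_hom hb) (pres_x_homog j)).
rewrite /pres_x !(ext_lt _ _ hj) /free_to_pres -!pM -pZ andbC.
exact/prel/nilHecke_ax.
Qed.

Lemma pres_tok_pres_x i j a : (j < n)%N -> scomm (pres_tok i a) (pres_x j).
Proof. exact: tens_pres_x. Qed.

Lemma pres_u_pres_x_far i j : (j < n)%N -> j != i -> j != i.+1 -> scomm (pres_u i) (pres_x j).
Proof.
move=> hj ji ji'; apply: (even_scomm (pres_u_even i) (pres_x_homog j)).
have [h1|h1] := ltnP i n.-1; last by rewrite /pres_u /ext insubN -?leqNgt // smul0l smul0r.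
rewrite /pres_u !(ext_lt _ _ h1) /pres_x !(ext_lt _ _ hj) /free_to_pres /nilCox_to_pres -!pM.
by apply/esym/prel/nilHecke_xu; rewrite -val_eqE.
Qed.

Definition pres_tau (i : nat) : P :=
  \sum_(b : fidx F) (-1) ^+ (eps && fpar b) *:
    (pres_tok i.+1 (fbas b) ** pres_tok i (fdual b)).

(** Brings τ to the form that the term [HTau] takes under evaluation. *)
Lemma tens_to_pres_tau (i : 'I_n.-1) : tens_to_pres (tau F i) = pres_tau i.
Proof.
rewrite (sahom_sum tens_to_pres_hom); apply: eq_bigr => b _.
rewrite (sahomZ tens_to_pres_hom) -(sahomM tens_to_pres_hom); congr (_ *: _).
rewrite tok_mul; last by rewrite ltnSn; apply: (ltn_ord (hi i)).
by [].
Qed.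

Lemma pres_u_pres_x_hi i : (i.+1 < n)%N ->
  pres_u i ** pres_x i.+1 = pres_x i ** pres_u i + pres_tau i.
Proof.
move=> h; have h1 : (i < n.-1)%N by lia.
have := prel (nilHecke_ux F (Ordinal h1)).
rewrite pD !pM -[quot_proj R (fp_inl _ (nilCox_A _))]/(tens_to_pres _)
  tens_to_pres_tau.
by rewrite -[quot_proj R (fp_inl _ _)]/(nilCox_to_pres _) -pres_uE
  -![quot_proj R (fp_inr _ _)]/(free_to_pres _) -!pres_xE.
Qed.

Lemma pres_x_pres_u_hi i : (i.+1 < n)%N ->
  pres_x i.+1 ** pres_u i = pres_u i ** pres_x i + (-1) ^+ eps *: pres_tau i.
Proof.
move=> h; have h1 : (i < n.-1)%N by lia.
have := prel (nilHecke_xu' F (Ordinal h1)).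
rewrite pD pZ !pM -[quot_proj R (fp_inl _ (nilCox_A _))]/(tens_to_pres _)
  tens_to_pres_tau.
by rewrite -[quot_proj R (fp_inl _ _)]/(nilCox_to_pres _) -pres_uE
  -![quot_proj R (fp_inr _ _)]/(free_to_pres _) -!pres_xE.
Qed.
End PresentedGenerators.

(** * Evaluation of morphism terms *)

Section Evaluation.
Variables (k : comPzRingType) (A : superAlgType k) (eps : bool).
Variables (F : symFrobenius A eps) (N : nat).
Local Notation P := (nilHeckePres F N).
Local Notation pres_u := (pres_u F N).
Local Notation pres_x := (pres_x F N).
Local Notation pres_tok := (pres_tok F N).

(* The value of [1 ⊗ f ⊗ 1_o] in the presented algebra on [N] strands. It is
   meaningful for [o + m <= N], and vanishes for [m != n]. *)
Fixpoint ev m n (f : hterm A m n) (o : nat) : P :=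
  match f with
  | HZero _ _ => 0
  | HAdd _ _ f g => ev f o + ev g o
  | HOpp _ _ f => - ev f o
  | HScale _ _ c f => c *: ev f o
  | HPart _ _ p f => part p (ev f o)
  | HId _ => sone
  | HComp _ _ _ f g => ev f o ** ev g o
  | HTens _ _ m' _ f g => ev f (o + m')%N ** ev g o
  | HCross => pres_u o
  | HDot => pres_x o
  | HTok a => pres_tok o a
  end.

(** Generators and identities have equal source and target. A composite or tensor product that does
    not must have a factor that does not, and the value of that factor is 0 by induction. *)
Lemma ev_neq m n (f : hterm A m n) o : m != n -> ev f o = 0.
Proof.
elim: f o => {m n} //= [m n f IHf g IHg|m n f IH|m n c f IH|m n p f IH|n|
  m n l f IHf g IHg|m n m' n' f IHf g IHg] o ne.
- by rewrite IHf // IHg // addr0.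
- by rewrite IH // oppr0.
- by rewrite IH // scaler0.
- by rewrite IH // part0.
- by rewrite eqxx in ne.
- have [e|ne'] := eqVneq n l; first by rewrite IHg ?smul0r // e.
  by rewrite IHf ?smul0l.
- have [e|ne'] := eqVneq m n; last by rewrite IHf ?smul0l.
  by rewrite IHg ?smul0r //; apply: contra ne => /eqP->; rewrite e.
Qed.

(** The value of [f] is built from generators on the strands [o], ..., [o + m - 1]. A crossing at
    [j] also occupies [j.+1], hence its sharper bound. *)
Lemma ev_scomm y m n (f : hterm A m n) o : (o + m <= N)%N ->
  (forall j a, (o <= j < o + m)%N -> scomm (pres_tok j a) y) ->
  (forall j, (o <= j < o + m)%N -> scomm (pres_x j) y) ->
  (forall j, (o <= j)%N -> (j.+1 < o + m)%N -> scomm (pres_u j) y) ->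
  scomm (ev f o) y.
Proof.
elim: f o => {m n} /= [m n|m n f IHf g IHg|m n f IH|m n c f IH|m n p f IH|n|
  m n l f IHf g IHg|m n m' n' f IHf g IHg|||a] o oN ht hx hu.
- exact: scomm0.
- by apply: scommD; [apply: IHf | apply: IHg].
- by apply: scommN; apply: IH.
- by apply: scommZ; apply: IH.
- by apply: scomm_part; apply: IH.
- exact: scomm1.
- have [e|ne] := eqVneq m n; last first.
    by rewrite (ev_neq g) // smul0r; apply: scomm0.
  by subst; apply: scommM; [apply: IHf | apply: IHg].
- apply: scommM.
    apply: IHf => [|j a oj|j oj|j oj oj']; try apply: ht; try apply: hx; try apply: hu; lia.
  apply: IHg => [|j a oj|j oj|j oj oj']; try apply: ht; try apply: hx; try apply: hu; lia.
- by apply: hu; lia.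
- by apply: hx; lia.
- by apply: ht; lia.
Qed.

(** Two uses of [ev_scomm], one for each argument, leave pairs of generators at disjoint positions,
    which supercommute by the relations of the presented algebra. *)
Lemma ev_far m n (f : hterm A m n) m' n' (g : hterm A m' n') o o' :
  (o' + m' <= o)%N -> (o + m <= N)%N -> scomm (ev f o) (ev g o').
Proof.
move=> h oN.
have hu i : (o <= i)%N -> (i.+1 < o + m)%N -> scomm (pres_u i) (ev g o').
  move=> oi io; apply: scomm_sym; apply: ev_scomm; first by lia.
  - by move=> j a oj; apply/scomm_sym/pres_u_pres_tok_far; lia.
  - by move=> j oj; apply/scomm_sym/pres_u_pres_x_far; lia.
  - move=> j oj jo; apply: (even_scomm (pres_u_even F N j) (pres_u_even F N i)).
    by apply: pres_u_far; lia.
apply: ev_scomm => // [i a oi|i oi]; apply: scomm_sym; (apply: ev_scomm; first by lia).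
- by move=> j b oj; apply: pres_tok_scomm; lia.
- by move=> j oj; apply/scomm_sym/pres_tok_pres_x; lia.
- by move=> j oj jo; apply: pres_u_pres_tok_far; lia.
- by move=> j b oj; apply: pres_tok_pres_x; lia.
- by move=> j oj; apply: pres_x_pres_x; lia.
- by move=> j oj jo; apply: pres_u_pres_x_far; lia.
Qed.

Lemma ev_HTau o : ev (HTau F) o = pres_tau F N o.
Proof.
rewrite /HTau (big_morph (fun f => ev f o) (id1 := 0) (op1 := +%R)) //.
by apply: eq_bigr => b _ /=; rewrite addn1.
Qed.

(** Equality of sources and targets is proved together with equality of values: the bound on the
    offset mentions the source, and must be carried across each step of the congruence. *)
Lemma heq_ev m n (f : hterm A m n) m' n' (g : hterm A m' n') : heq F f g ->
  [/\ m = m', n = n' & forall o, (o + m <= N)%N -> ev f o = ev g o].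
Proof.
elim=> {m n f m' n' g}.
- by [].
- by move=> m n m' n' f g _ [e1 e2 e]; split=> // o h; rewrite e // e1.
- move=> m n m' n' m'' n'' f g h _ [e1 e2 e] _ [e3 e4 e'].
  by split; [congruence | congruence | move=> o h'; rewrite e // e' // -e1].
- move=> m n m' n' f g f' g' _ [e1 e2 e] _ [_ _ e'].
  by split=> // o h /=; rewrite e // e'.
- by move=> m n m' n' f f' _ [e1 e2 e]; split=> // o h /=; rewrite e.
- by move=> c m n m' n' f f' _ [e1 e2 e]; split=> // o h /=; rewrite e.
- by move=> p m n m' n' f f' _ [e1 e2 e]; split=> // o h /=; rewrite e.
- move=> m n l m' n' l' f g f' g' _ [e1 e2 e] _ [e3 e4 e'].
  (* The bound concerns the source of [g]. It applies to [f] only if [g] preserves the number of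
     strands; otherwise [g'] has value 0 and both composites vanish. *)
  split=> // o h /=; rewrite e' //; have [e5|ne] := eqVneq m' n'; last first.
    by rewrite (ev_neq g') // !smul0r.
  by rewrite e // e1 -e5 -e3.
- move=> m1 n1 m2 n2 m1' n1' m2' n2' f g f' g' _ [e1 e2 e] _ [e3 e4 e'].
  split; try congruence; move=> o h /=; rewrite e ?e' ?e3 //; lia.
- by move=> m n f g h; split=> // o _ /=; rewrite addrA.
- by move=> m n f g; split=> // o _ /=; rewrite addrC.
- by move=> m n f; split=> // o _ /=; rewrite add0r.
- by move=> m n f; split=> // o _ /=; rewrite addNr.
- by move=> m n c c' f; split=> // o _ /=; rewrite scalerA.
- by move=> m n f; split=> // o _ /=; rewrite scale1r.
- by move=> m n c f g; split=> // o _ /=; rewrite scalerDr.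
- by move=> m n c c' f; split=> // o _ /=; rewrite scalerDl.
- by move=> m n p c f g; split=> // o _ /=; rewrite part_linear.
- by move=> m n p q f; split=> // o _ /=; rewrite part_part; case: eqP.
- by move=> m n f; split=> // o _ /=; rewrite part_sum.
- by move=> m n l r f g h; split=> // o _ /=; rewrite smulA.
- by move=> m n f; split=> // o _ /=; rewrite smul1l.
- by move=> m n f; split=> // o _ /=; rewrite smul1r.
- by move=> m n l f g h; split=> // o _ /=; rewrite smulDl.
- by move=> m n l f g h; split=> // o _ /=; rewrite smulDr.
- by move=> m n l c f g; split=> // o _ /=; rewrite smulZl.
- by move=> m n l c f g; split=> // o _ /=; rewrite smulZr.
- by move=> n; split=> // o _ /=; rewrite part_sone.
- by move=> m n l p q f g; split=> // o _ /=; rewrite part_smul.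
- move=> m1 n1 m2 n2 m3 n3 f g h; split; [exact: addnA|exact: addnA|].
  by move=> o _ /=; rewrite smulA -addnA (addnC m3) addnA.
- by move=> m n f; split=> // o _ /=; rewrite smul1l.
- by move=> m n f; split; rewrite ?addn0 // => o _ /=; rewrite smul1r addn0.
- by move=> m n; split=> // o _ /=; rewrite smul1r.
- by move=> m n m' n' f g h; split=> // o _ /=; rewrite smulDl.
- by move=> m n m' n' f g h; split=> // o _ /=; rewrite smulDr.
- by move=> m n m' n' c f g; split=> // o _ /=; rewrite smulZl.
- by move=> m n m' n' c f g; split=> // o _ /=; rewrite smulZr.
- by move=> m n m' n' p q f g; split=> // o _ /=; rewrite part_smul.
- move=> m n l m' n' l' p q f' g f g'; split=> // o h /=.
  (* The left side places [f'] at offset [o + n'], the right side at [o + m']. If these differ, [g']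
     has value 0; if not, [ev_far] exchanges the two middle factors. *)
  have [e|ne] := eqVneq m' n'; last by rewrite (ev_neq g') // !smul0r scaler0.
  subst m'; have e : scomm (ev f (o + n')) (ev g o) by apply: ev_far; lia.
  rewrite -!smulA (smulA _ (part p _)) (scomm_sym e) !smulZl !smulZr andbC.
  by rewrite -!smulA.
- by split=> // o _ /=; apply: pres_u_even.
- by split=> // o _ /=; apply: pres_x_homog.
- move=> p a; split=> // o h /=.
  by rewrite (sahom_part (@pres_tok_hom _ _ _ F N o _)) //; lia.
- by split=> // o h /=; rewrite (sahom1 (@pres_tok_hom _ _ _ F N o _)) //; lia.
- move=> c c' a b; split=> // o h /=.
  have H : sahom (pres_tok o) by apply: pres_tok_hom; lia.
  by rewrite (sahom_lin H) (sahomZ H).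
- move=> a b; split=> // o h /=.
  by rewrite (sahomM (@pres_tok_hom _ _ _ F N o _)) //; lia.
- by split=> // o h /=; apply: pres_u_sq.
- split=> // o h /=; rewrite !smul1l !smul1r addn1.
  by rewrite pres_u_braid //; lia.
- by move=> a; split=> // o h /=; rewrite smul1l smul1r addn1 pres_u_pres_tok_hi //; lia.
- by move=> a; split=> // o h /=; rewrite smul1l smul1r addn1 pres_u_pres_tok_lo //; lia.
(* Strands are counted from the right, so the dot of [d ⊗ 1_1] sits at [o.+1] and that of [1_1 ⊗ d]
   at [o]. *)
- split=> // o h; rewrite ev_HTau /= smul1l smul1r addn1 pres_u_pres_x_hi; last by lia.
  by rewrite addrC addrA addNr add0r.
- split=> // o h; rewrite [RHS]/= ev_HTau /= smul1l smul1r addn1 pres_x_pres_u_hi; last by lia.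
  by rewrite addrC addrA addNr add0r.
- move=> p a ha; split=> // o h /=.
  have H : sahom (pres_tok o) by apply: pres_tok_hom; lia.
  have /(scomm_homog (sahom_homog H ha) (pres_x_homog F N o)) -> :
      scomm (pres_tok o a) (pres_x o).
    by apply: pres_tok_pres_x; lia.
  by rewrite andbC.
Qed.
End Evaluation.

(** * Placing a morphism among identity strands *)

Section Padding.
Variables (k : comPzRingType) (A : superAlgType k) (eps : bool).
Variables (F : symFrobenius A eps).
Local Notation hcls := (cls (heq_equiv F _ _)).
Local Notation id_ n := (hid F n).

Section Bilinear.
Variables m n l m' n' : nat.

Lemma hcomp_linl c (f f' : hhom F n l) (g : hhom F m n) :
  hcomp (c *: f + f') g = c *: hcomp f g + hcomp f' g.
Proof.
elim/cls_ind: f => f; elim/cls_ind: f' => f'; elim/cls_ind: g => g.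
rewrite -[c *: _ + _]/(hadd (hscale c _) _) -[RHS]/(hadd (hscale c _) _).
rewrite !(cls_hadd, cls_hscale, cls_hcomp); apply/clsP.
exact: heq_trans (heq_compDl _ _ _ _) (heq_add (heq_compZl _ _ _ _) (heq_refl _ _)).
Qed.

Lemma hcomp_linr c (f : hhom F n l) (g g' : hhom F m n) :
  hcomp f (c *: g + g') = c *: hcomp f g + hcomp f g'.
Proof.
elim/cls_ind: f => f; elim/cls_ind: g => g; elim/cls_ind: g' => g'.
rewrite -[c *: _ + _]/(hadd (hscale c _) _) -[RHS]/(hadd (hscale c _) _).
rewrite !(cls_hadd, cls_hscale, cls_hcomp); apply/clsP.
exact: heq_trans (heq_compDr _ _ _ _) (heq_add (heq_compZr _ _ _ _) (heq_refl _ _)).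
Qed.

Lemma htens_linl c (f f' : hhom F m n) (g : hhom F m' n') :
  htens (c *: f + f') g = c *: htens f g + htens f' g.
Proof.
elim/cls_ind: f => f; elim/cls_ind: f' => f'; elim/cls_ind: g => g.
rewrite -[c *: _ + _]/(hadd (hscale c _) _) -[RHS]/(hadd (hscale c _) _).
rewrite !(cls_hadd, cls_hscale, cls_htens); apply/clsP.
exact: heq_trans (heq_tensDl _ _ _ _) (heq_add (heq_tensZl _ _ _ _) (heq_refl _ _)).
Qed.

Lemma htens_linr c (f : hhom F m n) (g g' : hhom F m' n') :
  htens f (c *: g + g') = c *: htens f g + htens f g'.
Proof.
elim/cls_ind: f => f; elim/cls_ind: g => g; elim/cls_ind: g' => g'.
rewrite -[c *: _ + _]/(hadd (hscale c _) _) -[RHS]/(hadd (hscale c _) _).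
rewrite !(cls_hadd, cls_hscale, cls_htens); apply/clsP.
exact: heq_trans (heq_tensDr _ _ _ _) (heq_add (heq_tensZr _ _ _ _) (heq_refl _ _)).
Qed.

Lemma hcomp_addl (f f' : hhom F n l) (g : hhom F m n) :
  hcomp (f + f') g = hcomp f g + hcomp f' g.
Proof. by have := hcomp_linl 1 f f' g; rewrite !scale1r. Qed.
Lemma hcomp_addr (f : hhom F n l) (g g' : hhom F m n) :
  hcomp f (g + g') = hcomp f g + hcomp f g'.
Proof. by have := hcomp_linr 1 f g g'; rewrite !scale1r. Qed.
Lemma htens_addl (f f' : hhom F m n) (g : hhom F m' n') :
  htens (f + f') g = htens f g + htens f' g.
Proof. by have := htens_linl 1 f f' g; rewrite !scale1r. Qed.
Lemma htens_addr (f : hhom F m n) (g g' : hhom F m' n') :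
  htens f (g + g') = htens f g + htens f g'.
Proof. by have := htens_linr 1 f g g'; rewrite !scale1r. Qed.

Lemma hcomp0l (g : hhom F m n) : hcomp (0 : hhom F n l) g = 0.
Proof. by apply: (addrI (hcomp 0 g)); rewrite -hcomp_addl !addr0. Qed.
Lemma hcomp0r (f : hhom F n l) : hcomp f (0 : hhom F m n) = 0.
Proof. by apply: (addrI (hcomp f 0)); rewrite -hcomp_addr !addr0. Qed.
Lemma htens0l (g : hhom F m' n') : htens (0 : hhom F m n) g = 0.
Proof. by apply: (addrI (htens 0 g)); rewrite -htens_addl !addr0. Qed.
Lemma htens0r (f : hhom F m n) : htens f (0 : hhom F m' n') = 0.
Proof. by apply: (addrI (htens f 0)); rewrite -htens_addr !addr0. Qed.

Lemma htens_homog p q (f : hhom F m n) (g : hhom F m' n') :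
  homog p f -> homog q g -> homog (p (+) q) (htens f g).
Proof.
elim/cls_ind: f => f; elim/cls_ind: g => g.
rewrite /homog => <- <-.
rewrite -[part p _]/(hpart p _) -[part q _]/(hpart q _).
rewrite -[part _ (htens _ _)]/(hpart _ _) !(cls_hpart, cls_htens).
by apply/clsP; apply: heq_part_tens.
Qed.
End Bilinear.

(** The analogue of [ev_neq] inside the category; [of_pres_ev] needs both to match the vanishing of
    the two sides. *)
Lemma hhom_neq m n (f : hhom F m n) : m != n -> f = 0.
Proof.
elim/cls_ind: f; elim=> {m n} [m n|m n f IHf g IHg|m n f IH|m n c f IH|m n p f IH|n|
  m n l f IHf g IHg|m n m' n' f IHf g IHg|||a] ne //.
- rewrite -cls_hadd IHf // IHg //; exact: add0r.
- rewrite -cls_hopp IH //; exact: oppr0.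
- rewrite -cls_hscale IH //; exact: scaler0.
- rewrite -cls_hpart IH //; exact: part0.
- by rewrite eqxx in ne.
- rewrite -cls_hcomp; have [e|ne'] := eqVneq n l; first by rewrite IHg ?hcomp0r // e.
  by rewrite IHf ?hcomp0l.
- rewrite -cls_htens; have [e|ne'] := eqVneq m n; last by rewrite IHf ?htens0l.
  by rewrite IHg ?htens0r //; apply: contra ne => /eqP->; rewrite e.
Qed.

Lemma hid_even n : homog false (id_ n).
Proof. exact: hpart_id. Qed.

Lemma hcomp_id_l m n (f : hhom F m n) : hcomp (id_ n) f = f.
Proof. elim/cls_ind: f => f; rewrite cls_hcomp; apply/clsP; exact: heq_id_l. Qed.
Lemma hcomp_id_r m n (f : hhom F m n) : hcomp f (id_ m) = f.
Proof. elim/cls_ind: f => f; rewrite cls_hcomp; apply/clsP; exact: heq_id_r. Qed.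

Lemma hinterchange m n l m' n' l' p q (f' : hhom F n l) (g : hhom F n' l')
    (f : hhom F m n) (g' : hhom F m' n') : homog p f -> homog q g ->
  hcomp (htens f' g) (htens f g') =
  (-1) ^+ (p && q) *: htens (hcomp f' f) (hcomp g g').
Proof.
elim/cls_ind: f' => f'; elim/cls_ind: g => g; elim/cls_ind: f => f.
elim/cls_ind: g' => g'; rewrite /homog => <- <-.
rewrite -[part p _]/(hpart p _) -[part q _]/(hpart q _) -[RHS]/(hscale _ _).
rewrite !(cls_hpart, cls_htens, cls_hcomp, cls_htens, cls_hscale).
by apply/clsP; apply: heq_interchange.
Qed.

Lemma hinterchange_l m n m' n' l' (f' : hhom F m n) (g : hhom F n' l')
    (g' : hhom F m' n') :
  hcomp (htens f' g) (htens (id_ m) g') = htens f' (hcomp g g').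
Proof.
rewrite -[g]part_sum htens_addr hcomp_addl hcomp_addl htens_addr.
rewrite !(hinterchange _ _ (hid_even m) (homog_part _ g)) !scale1r.
by rewrite hcomp_id_r.
Qed.

Lemma hinterchange_r m n l m' n' (f' : hhom F n l) (f : hhom F m n)
    (g' : hhom F m' n') :
  hcomp (htens f' (id_ n')) (htens f g') = htens (hcomp f' f) g'.
Proof.
rewrite -[f]part_sum htens_addl hcomp_addr hcomp_addr htens_addl.
rewrite !(hinterchange _ _ (homog_part _ f) (hid_even n')) !andbF !scale1r.
by rewrite hcomp_id_l.
Qed.

Lemma htens_id m n : htens (id_ m) (id_ n) = id_ (m + n).
Proof. rewrite cls_htens; apply/clsP; exact: heq_tens_id. Qed.

Lemma htens_idl_hom r m : sahom (htens (id_ r) : nilHecke F m -> nilHecke F (r + m)).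
Proof.
split=> [c f g||f g|p f].
- exact: htens_linr.
- exact: htens_id.
- exact/esym/hinterchange_l.
- rewrite -{2}[f]part_sum htens_addr partD.
  have h q : homog q (htens (id_ r) (part q f)).
    exact: (htens_homog (hid_even r) (homog_part q f)).
  by rewrite !(part_homog p (h _)); case: p; rewrite ?add0r ?addr0.
Qed.

Lemma htens_idr_hom o m :
  sahom ((fun f => htens f (id_ o)) : nilHecke F m -> nilHecke F (m + o)).
Proof.
split=> [c f g||f g|p f].
- exact: htens_linl.
- exact: htens_id.
- exact/esym/hinterchange_r.
- rewrite -{2}[f]part_sum htens_addl partD.
  have h q : homog q (htens (part q f) (id_ o)).
    by have := htens_homog (homog_part q f) (hid_even o); rewrite addbF.
  by rewrite !(part_homog p (h _)); case: p; rewrite ?add0r ?addr0.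
Qed.

(** By interchange both products are [htens f g] on homogeneous parts, one without sign and the
    other with (-1)^(pq), whose square is 1. *)
Lemma htens_scomm m n (f : nilHecke F m) (g : nilHecke F n) :
  scomm (htens f (id_ n) : nilHecke F (m + n)) (htens (id_ m) g).
Proof.
move=> p q; rewrite -(sahom_part (htens_idr_hom n m)) -(sahom_part (htens_idl_hom m n)).
rewrite [LHS]hinterchange_l [X in _ *: X](hinterchange _ _ (homog_part p f) (homog_part q g)).
rewrite scalerA -expr2 -exprM mulnC exprM sqrrN expr1n expr1n scale1r.
by rewrite !hcomp_id_l !hcomp_id_r.
Qed.

Definition hcast m n (e : m = n) (f : nilHecke F m) : nilHecke F n :=
  ecast n (nilHecke F n) e f.

Lemma hcast_hom m n (e : m = n) : sahom (hcast e).
Proof. by case: n / e. Qed.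

Lemma hcast_heq m n (e : m = n) (f : hterm A m m) (g : hterm A n n) :
  heq F f g -> hcast e (hcls f) = hcls g.
Proof. by move: g; case: n / e => g h; apply/clsP. Qed.

Lemma rep_hcast m n (e : m = n) (f : hterm A m m) :
  heq F (rep (hcast e (hcls f))) f.
Proof. by case: n / e; apply: (rep_cls (heq_equiv F _ _)). Qed.

Variable N : nat.

(* [1 ⊗ f ⊗ 1_o]; the zero morphism when it does not fit into [N] strands. *)
Definition hpad o m (f : nilHecke F m) : nilHecke F N :=
  match @eqP _ (N - (o + m) + (m + o))%N N with
  | ReflectT e => hcast e (htens (id_ (N - (o + m))) (htens f (id_ o)))
  | ReflectF _ => 0
  end.

Lemma hpad_hom o m : (o + m <= N)%N -> sahom (@hpad o m).
Proof.
move=> h; rewrite /hpad; case: eqP => [e|ne]; last by exfalso; lia.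
apply: (sahom_comp (hcast_hom e)).
exact: sahom_comp (htens_idl_hom _ _) (htens_idr_hom _ _).
Qed.

(** Trades the cast in [hpad] for a heterogeneous relation between terms, where propositionally
    equal types cause no difficulty. *)
Lemma hpad_heq o m (f : hterm A m m) (g : hterm A N N) : (o + m <= N)%N ->
  heq F (HTens (HId A (N - (o + m))) (HTens f (HId A o))) g ->
  hpad o (hcls f : nilHecke F m) = hcls g.
Proof.
move=> h fg; rewrite /hpad; case: eqP => [e|ne]; last by exfalso; lia.
by rewrite (cls_htens F f (HId A o)) cls_htens; apply: hcast_heq.
Qed.

Lemma rep_hpad o m (f : hterm A m m) : (o + m <= N)%N ->
  heq F (rep (hpad o (hcls f : nilHecke F m)))
        (HTens (HId A (N - (o + m))) (HTens f (HId A o))).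
Proof.
move=> h; rewrite /hpad; case: eqP => [e|ne]; last by exfalso; lia.
rewrite (cls_htens F f (HId A o)) cls_htens.
exact: rep_hcast.
Qed.

Lemma heq_id m n : m = n -> heq F (HId A m) (HId A n).
Proof. by move->; apply: heq_refl. Qed.

(** This is 1 ⊗ f ⊗ g ⊗ 1 = (1 ⊗ f ⊗ 1) ∘ (1 ⊗ g ⊗ 1), the counterpart of the tensor clause of
    [ev]. *)
Lemma hpad_tens o m m' (f : nilHecke F m) (g : nilHecke F m') :
  (o + (m + m') <= N)%N ->
  hpad o (htens f g : nilHecke F (m + m')) = hpad (o + m') f ** hpad o g.
Proof.
elim/cls_ind: f => f; elim/cls_ind: g => g h; rewrite cls_htens.
rewrite -[RHS]/(hcomp _ _) -(repK (hpad (o + m') _)) -(repK (hpad o (hcls g))) cls_hcomp.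
apply: hpad_heq => //; set r := (N - _)%N.
(* [f'] and [g'] bracket the identity strands so that the two terms have literally the same source
   and target; only then do composition and interchange apply. *)
apply: heq_sym; pose f' := HTens (HId A r) (HTens f (HId A (m' + o))).
pose g' := HTens (HId A r) (HTens (HId A m) (HTens g (HId A o))).
apply: (@heq_trans _ _ _ _ _ _ _ _ _ _ _ (HComp f' g')).
  apply: heq_comp.
    rewrite /f'; apply: heq_trans (@rep_hpad _ _ f _) _; first by lia.
    by apply: heq_tens; [apply: heq_id; lia | apply: heq_tens (heq_refl _ _) (heq_id _); lia].
  apply: heq_trans (@rep_hpad _ _ g _) _; first by lia.
  rewrite /g'; apply: heq_trans (heq_sym (heq_tensA _ _ _ _)).
  apply: heq_tens (heq_refl _ _); apply: heq_sym.
  by apply: heq_trans (heq_tens_id _ _ _) (heq_id _); lia.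
apply: (@heq_trans _ _ _ _ _ _ _ _ _ _ _ (HTens (HId A r) (HTens f (HTens g (HId A o))))).
  have /clsP : hcls (HComp f' g') =
      hcls (HTens (HId A r) (HTens f (HTens g (HId A o)))).
    rewrite -cls_hcomp -!cls_htens hinterchange_l hinterchange_l.
    by rewrite [hcomp _ (htens _ _)]hcomp_id_l.
  exact.
apply: heq_tens (heq_refl _ _) _; exact: heq_tensA.
Qed.

Lemma hpad_id o m : (o + m <= N)%N -> hpad o (id_ m) = sone.
Proof. by move=> h; apply: (sahom1 (hpad_hom h)). Qed.

Lemma hpad_tens_idl o m n (f : nilHecke F n) : (o + (m + n) <= N)%N ->
  hpad o (htens (id_ m) f : nilHecke F (m + n)) = hpad o f.
Proof. by move=> h; rewrite hpad_tens // hpad_id ?smul1l //; lia. Qed.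

Lemma hpad_tens_idr o m n (f : nilHecke F m) : (o + (m + n) <= N)%N ->
  hpad o (htens f (id_ n) : nilHecke F (m + n)) = hpad (o + n) f.
Proof. by move=> h; rewrite hpad_tens // hpad_id ?smul1r //; lia. Qed.

Lemma hpad_scomm o m (f : nilHecke F m) o' m' (g : nilHecke F m') :
  (o' + m' <= o)%N -> (o + m <= N)%N -> scomm (hpad o f) (hpad o' g).
Proof.
(* Both morphisms become paddings at the same offset [o'] of [f ⊗ 1] and [1 ⊗ g] on [m + (gap + m')]
   strands, where [htens_scomm] applies. *)
move=> h h'; pose gap := (o - (o' + m'))%N.
have hN : (o' + (m + (gap + m')) <= N)%N by rewrite /gap; lia.
have -> : hpad o f = hpad o' (htens f (id_ (gap + m')) : nilHecke F _).
  by rewrite hpad_tens_idr //; congr (hpad _ f); rewrite /gap; lia.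
have -> : hpad o' g =
    hpad o' (htens (id_ m) (htens (id_ gap) g : nilHecke F _) : nilHecke F _).
  by rewrite !hpad_tens_idl //; lia.
exact: sahom_scomm (hpad_hom hN) (htens_scomm _ _).
Qed.
End Padding.

(** * The inverse homomorphism *)

Section Inverse.
Variables (k : comPzRingType) (A : superAlgType k) (eps : bool).
Variables (F : symFrobenius A eps) (N : nat).
Local Notation hcls := (cls (heq_equiv F _ _)).
Local Notation id_ n := (hid F n).
Local Notation P := (nilHeckePres F N).
Local Notation H := (nilHecke F N).

Lemma cls_smul n (f g : hterm A n n) :
  (hcls f : nilHecke F n) ** (hcls g : nilHecke F n) = hcls (HComp f g).
Proof. exact: cls_hcomp. Qed.

Lemma heq_cls m n (f g : hterm A m n) : heq F f g -> hcls f = hcls g.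
Proof. by move=> e; apply/clsP. Qed.

Definition hcross : nilHecke F 2 := hcls (HCross A).
Definition hdot : nilHecke F 1 := hcls (HDot A).
Definition htok (a : A) : nilHecke F 1 := hcls (HTok a).
(** Restates the index [1 + 1] of [htens] as [2], so that the result can be multiplied with
    [hcross]. *)
Definition tens11 (f g : nilHecke F 1) : nilHecke F 2 := htens f g.

Definition cross_at j : H := hpad N j hcross.
Definition dot_at j : H := hpad N j hdot.
Definition tok_at j (a : A) : H := hpad N j (htok a).

Lemma hcross_even : homog false hcross.
Proof. rewrite /homog [LHS]cls_hpart; apply/clsP; exact: heq_par_cross. Qed.
Lemma hdot_homog : homog eps hdot.
Proof. rewrite /homog [LHS]cls_hpart; apply/clsP; exact: heq_par_dot. Qed.
Lemma htok_hom : sahom htok.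
Proof.
split=> [c a b||a b|p a].
- rewrite -[X in htok (_ + X)]scale1r -[X in _ = _ + X]scale1r.
  rewrite -[RHS]/(hadd (hscale c _) (hscale 1 _)) !cls_hscale cls_hadd.
  apply/clsP; exact: heq_tok_linear.
- by apply/clsP; apply: heq_tok1.
- rewrite [RHS]cls_hcomp; apply/clsP; exact: heq_sym (heq_tokM _ _ _).
- rewrite [RHS]cls_hpart; apply/clsP; exact: heq_sym (heq_par_tok _ _ _).
Qed.

Lemma hcross_sq : hcross ** hcross = 0.
Proof. rewrite [LHS]cls_hcomp; apply/clsP; exact: heq_cross_sq. Qed.

Lemma hcross_tok_l a :
  hcross ** tens11 (htok a) (id_ 1) = tens11 (id_ 1) (htok a) ** hcross.
Proof.
rewrite /tens11 !cls_htens [LHS]cls_hcomp [RHS]cls_hcomp.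
apply/clsP; exact: heq_cross_tok_l.
Qed.
Lemma hcross_tok_r a :
  hcross ** tens11 (id_ 1) (htok a) = tens11 (htok a) (id_ 1) ** hcross.
Proof.
rewrite /tens11 !cls_htens [LHS]cls_hcomp [RHS]cls_hcomp.
apply/clsP; exact: heq_cross_tok_r.
Qed.

Definition htau : nilHecke F 2 := \sum_(b : fidx F)
  (-1) ^+ (eps && fpar b) *: tens11 (htok (fbas b)) (htok (fdual b)).

Lemma htau_cls : htau = hcls (HTau F).
Proof.
rewrite /htau /HTau; elim/big_rec2: _ => // b x y _ ->.
rewrite /tens11 cls_htens -[LHS]/(hadd (hscale _ _) _) cls_hscale.
exact: cls_hadd.
Qed.

Lemma hcross_dot :
  hcross ** tens11 hdot (id_ 1) = tens11 (id_ 1) hdot ** hcross + htau.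
Proof.
suff <- : hcross ** tens11 hdot (id_ 1) - tens11 (id_ 1) hdot ** hcross = htau.
  by rewrite addrC subrK.
rewrite /tens11 !cls_htens !cls_smul htau_cls -[LHS]/(hadd _ (hopp _)) cls_hopp cls_hadd.
apply/clsP; exact: heq_cross_dot.
Qed.
Lemma dot_hcross :
  tens11 hdot (id_ 1) ** hcross =
  hcross ** tens11 (id_ 1) hdot + (-1) ^+ eps *: htau.
Proof.
suff <- : tens11 hdot (id_ 1) ** hcross - hcross ** tens11 (id_ 1) hdot =
    (-1) ^+ eps *: htau.
  by rewrite addrC subrK.
rewrite /tens11 !cls_htens !cls_smul htau_cls -[LHS]/(hadd _ (hopp _)) cls_hopp cls_hadd.
rewrite [RHS]cls_hscale; apply/clsP; exact: heq_dot_cross.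
Qed.

Lemma tok_dot p a : homog p a -> htok a ** hdot = (-1) ^+ (eps && p) *: (hdot ** htok a).
Proof.
move=> ha; rewrite [LHS]cls_hcomp -[X in _ *: X]/(hcomp _ _) cls_hcomp [RHS]cls_hscale.
by apply/clsP; apply: heq_tok_dot.
Qed.

Lemma htok_hdot_scomm a : scomm (htok a) hdot.
Proof.
suff E p b : homog p b -> scomm (htok b) hdot.
  rewrite -[a]part_sum (sahomD htok_hom).
  by apply: scommD; apply: E (homog_part _ _).
move=> hb; apply/(scomm_homog (sahom_homog htok_hom hb) hdot_homog).
by rewrite (tok_dot hb) andbC.
Qed.

Lemma cross_at_even j : (j.+1 < N)%N -> homog false (cross_at j).
Proof. by move=> h; apply: (sahom_homog (hpad_hom F _) hcross_even); lia. Qed.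
Lemma dot_at_homog j : (j < N)%N -> homog eps (dot_at j).
Proof. by move=> h; apply: (sahom_homog (hpad_hom F _) hdot_homog); lia. Qed.
Lemma tok_at_hom j : (j < N)%N -> sahom (tok_at j).
Proof. by move=> h; apply: (sahom_comp (hpad_hom F _) htok_hom); lia. Qed.

(** With [hpad_l], this writes whatever meets a crossing at [j] as a two-strand morphism padded at
    [j]; the local relations are then transported by the single homomorphism [hpad N j]. *)
Lemma hpad_r j (f : nilHecke F 1) : (j.+1 < N)%N ->
  hpad N j.+1 f = hpad N j (tens11 f (id_ 1)).
Proof. by move=> h; rewrite -[j.+1]addn1; apply/esym/(@hpad_tens_idr _ _ _ F N j 1 1); lia. Qed.
Lemma hpad_l j (f : nilHecke F 1) : (j.+1 < N)%N ->
  hpad N j f = hpad N j (tens11 (id_ 1) f).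
Proof. by move=> h; apply/esym/(@hpad_tens_idl _ _ _ F N j 1 1); lia. Qed.

Section Local.
Variable j : nat.
Hypothesis h : (j.+1 < N)%N.
Let h2 : (j + 2 <= N)%N. Proof. lia. Qed.
Let M := sahomM (hpad_hom F h2).
Let D := sahomD (hpad_hom F h2).
Let Z := sahomZ (hpad_hom F h2).

Lemma cross_at_sq : cross_at j ** cross_at j = 0.
Proof. by rewrite -M hcross_sq (sahom0 (hpad_hom F h2)). Qed.
Lemma cross_at_tok_at_hi a : cross_at j ** tok_at j.+1 a = tok_at j a ** cross_at j.
Proof. by rewrite /tok_at hpad_r // (hpad_l _ h) -!M hcross_tok_l. Qed.
Lemma cross_at_tok_at_lo a : cross_at j ** tok_at j a = tok_at j.+1 a ** cross_at j.
Proof. by rewrite /tok_at hpad_r // (hpad_l _ h) -!M hcross_tok_r. Qed.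

Lemma hpad_htau : hpad N j htau = \sum_(b : fidx F)
  (-1) ^+ (eps && fpar b) *: (tok_at j.+1 (fbas b) ** tok_at j (fdual b)).
Proof.
rewrite /htau (sahom_sum (hpad_hom F h2)); apply: eq_bigr => b _.
by rewrite Z -[j.+1]addn1; congr (_ *: _); apply: (@hpad_tens _ _ _ F N j 1 1).
Qed.

Lemma cross_at_dot_at_hi :
  cross_at j ** dot_at j.+1 = dot_at j ** cross_at j + hpad N j htau.
Proof. by rewrite /dot_at hpad_r // (hpad_l _ h) -!M -D hcross_dot. Qed.
Lemma dot_at_cross_at_hi :
  dot_at j.+1 ** cross_at j =
  cross_at j ** dot_at j + (-1) ^+ eps *: hpad N j htau.
Proof. by rewrite /dot_at hpad_r // (hpad_l _ h) -!M -Z -D dot_hcross. Qed.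
End Local.

Lemma cross_at_braid j : (j.+2 < N)%N ->
  cross_at j ** cross_at j.+1 ** cross_at j = cross_at j.+1 ** cross_at j ** cross_at j.+1.
Proof.
move=> h; have h3 : (j + 3 <= N)%N by lia.
(* [a] is the crossing at [j] and [b] the one at [j.+1]; the braid relation of the category begins
   with [b], hence the symmetry at the end. *)
pose a : hterm A 3 3 := HTens (HId A 1) (HCross A).
pose b : hterm A 3 3 := HTens (HCross A) (HId A 1).
have -> : cross_at j = hpad N j (hcls a : nilHecke F 3).
  apply: etrans (esym (@hpad_tens_idl _ _ _ F N j 1 2 _ _)) _ => //.
  by congr hpad; apply: cls_htens.
have -> : cross_at j.+1 = hpad N j (hcls b : nilHecke F 3).
  rewrite -[j.+1]addn1.
  apply: etrans (esym (@hpad_tens_idr _ _ _ F N j 2 1 _ _)) _ => //.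
  by congr hpad; apply: cls_htens.
rewrite -!(sahomM (hpad_hom F h3)) (cls_smul a b) (cls_smul b a) !cls_smul.
by congr hpad; apply/clsP; apply: heq_sym; apply: heq_braid.
Qed.

Lemma hpad_far_scomm i m (f : nilHecke F m) j m' (g : nilHecke F m') :
  (i + m <= N)%N -> (j + m' <= N)%N -> (i + m <= j)%N || (j + m' <= i)%N ->
  scomm (hpad N i f) (hpad N j g).
Proof.
move=> hi hj /orP[ij|ji]; last exact: hpad_scomm.
by apply: scomm_sym; apply: hpad_scomm.
Qed.

(** One lift for each layer of the presentation. Verifying the relations of a layer uses that the
    lift on the layer below is a homomorphism. *)
Definition of_pres_tens : tens A N -> H := tensor_lift tok_at.
Definition of_pres_cox_base : nilCox_base A N -> H :=
  fprod_lift of_pres_tens (free_lift (par := fun=> false) (fun i : 'I_N.-1 => cross_at i)).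
Definition of_pres_cox : nilCox A N -> H := quot_lift of_pres_cox_base.
Definition of_pres_base : nilHecke_base A eps N -> H :=
  fprod_lift of_pres_cox (free_lift (par := fun=> eps) (fun i : 'I_N => dot_at i)).
Definition of_pres : P -> H := quot_lift of_pres_base.

Lemma of_pres_tens_hom : sahom of_pres_tens.
Proof.
apply: tensor_lift_hom => [j|i j a b ij]; first exact: tok_at_hom.
by apply: hpad_far_scomm; lia.
Qed.

Let cox_free_hom : sahom (free_lift (par := fun=> false) (fun i : 'I_N.-1 => cross_at i)).
Proof. by apply: free_lift_hom => i; apply: cross_at_even; have := ltn_ord i; lia. Qed.
Let free_hom : sahom (free_lift (par := fun=> eps) (fun i : 'I_N => dot_at i)).
Proof. by apply: free_lift_hom => i; apply: dot_at_homog. Qed.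

Lemma of_pres_cox_base_hom : sahom of_pres_cox_base.
Proof. exact: fprod_lift_hom of_pres_tens_hom cox_free_hom. Qed.

Lemma of_pres_cox_base_u i : of_pres_cox_base (fp_inr _ (free_gen k _ i)) = cross_at i.
Proof.
rewrite /of_pres_cox_base fprod_lift_r; [|exact: of_pres_tens_hom|exact: cox_free_hom].
by apply: free_lift_gen => l; apply: cross_at_even; have := ltn_ord l; lia.
Qed.

Lemma of_pres_cox_base_A a : of_pres_cox_base (fp_inl _ a) = of_pres_tens a.
Proof. by apply: fprod_lift_l; [exact: of_pres_tens_hom|exact: cox_free_hom]. Qed.

Lemma of_pres_cox_base_rel x y : nilCox_rel x y -> of_pres_cox_base x = of_pres_cox_base y.
Proof.
have M := sahomM of_pres_cox_base_hom.
case=> [i|i j ij|i j ij|i a]; rewrite !M ?of_pres_cox_base_u ?of_pres_cox_base_A.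
- by rewrite (sahom0 of_pres_cox_base_hom) cross_at_sq //; have := ltn_ord i; lia.
- have := ltn_ord i; have := ltn_ord j => hj hi.
  by apply: scomm_even; [apply: cross_at_even | apply: hpad_far_scomm]; lia.
- by rewrite ij; apply: cross_at_braid; have := ltn_ord j; lia.
- have hi := ltn_ord i; apply: tensor_lift_swap.
  + by move=> j; apply: tok_at_hom.
  + by move=> l j b c lj; apply: hpad_far_scomm; lia.
  + by apply: cross_at_even; lia.
  + by move=> b; apply: cross_at_tok_at_hi; lia.
  + by move=> b; apply: cross_at_tok_at_lo; lia.
  + by move=> j b jn ji ji'; apply: hpad_far_scomm; lia.
Qed.

Lemma of_pres_cox_hom : sahom of_pres_cox.
Proof. exact: quot_lift_hom of_pres_cox_base_hom of_pres_cox_base_rel. Qed.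

Lemma of_pres_cox_u i : of_pres_cox (nilCox_u A i) = cross_at i.
Proof.
by rewrite -of_pres_cox_base_u; apply: quot_lift_proj;
  [exact: of_pres_cox_base_hom | exact: of_pres_cox_base_rel].
Qed.

Lemma of_pres_cox_A a : of_pres_cox (nilCox_A a) = of_pres_tens a.
Proof.
by rewrite -of_pres_cox_base_A; apply: quot_lift_proj;
  [exact: of_pres_cox_base_hom | exact: of_pres_cox_base_rel].
Qed.

Lemma of_pres_base_hom : sahom of_pres_base.
Proof. exact: fprod_lift_hom of_pres_cox_hom free_hom. Qed.

Lemma of_pres_base_l x : of_pres_base (fp_inl _ x) = of_pres_cox x.
Proof. by apply: fprod_lift_l; [exact: of_pres_cox_hom | exact: free_hom]. Qed.

Lemma of_pres_base_x i : of_pres_base (fp_inr _ (free_gen k _ i)) = dot_at i.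
Proof.
rewrite /of_pres_base fprod_lift_r; [|exact: of_pres_cox_hom|exact: free_hom].
by apply: free_lift_gen => l; apply: dot_at_homog.
Qed.

Lemma of_pres_tens_tau (i : 'I_N.-1) : of_pres_tens (tau F i) = hpad N i htau.
Proof.
have hi : (i.+1 < N)%N by have := ltn_ord i; lia.
rewrite hpad_htau // (sahom_sum of_pres_tens_hom); apply: eq_bigr => b _.
rewrite (sahomZ of_pres_tens_hom); congr (_ *: _).
rewrite -(tensor_lift_tok (fbas b) tok_at_hom hi).
rewrite -(tensor_lift_tok (fdual b) tok_at_hom (ltnW hi)).
rewrite -(sahomM of_pres_tens_hom) tok_mul //.
by rewrite ltnSn.
Qed.

Lemma of_pres_base_rel x y : nilHecke_rel F x y -> of_pres_base x = of_pres_base y.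
Proof.
have M := sahomM of_pres_base_hom; have D := sahomD of_pres_base_hom.
have Z := sahomZ of_pres_base_hom.
case=> [i j ij|p a i ha|i j ji ji'|i|i].
- rewrite Z !M !of_pres_base_x; have := ltn_ord i; have := ltn_ord j => hj hi.
  suff /(scomm_homog (dot_at_homog hi) (dot_at_homog hj)) -> : scomm (dot_at i) (dot_at j).
    by rewrite andbb.
  by move: ij; rewrite -val_eqE /= => ij; apply: hpad_far_scomm; lia.
- rewrite Z !M of_pres_base_x of_pres_base_l of_pres_cox_A andbC.
  have hi := ltn_ord i.
  apply/(scomm_homog (sahom_homog of_pres_tens_hom ha) (dot_at_homog hi)).
  apply: tensor_lift_scomm => [j|j b jn]; first exact: tok_at_hom.
  (* On a common strand the relation between token and dot is used; on different strands,
     disjointness. *)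
  have [e|ne] := eqVneq j i.
    rewrite e; apply: sahom_scomm (htok_hdot_scomm b).
    by apply: hpad_hom; lia.
  by apply: hpad_far_scomm; lia.
- rewrite !M of_pres_base_x of_pres_base_l of_pres_cox_u; apply/esym/scomm_even.
    by apply: cross_at_even; have := ltn_ord i; lia.
  have := ltn_ord i; have := ltn_ord j; move: ji ji'; rewrite -!val_eqE /=.
  by move=> ji ji' hj hi; apply: hpad_far_scomm; lia.
- rewrite D !M !of_pres_base_x !of_pres_base_l of_pres_cox_u of_pres_cox_A of_pres_tens_tau.
  by apply: cross_at_dot_at_hi; have := ltn_ord i; lia.
- rewrite D Z !M !of_pres_base_x !of_pres_base_l of_pres_cox_u of_pres_cox_A of_pres_tens_tau.
  by apply: dot_at_cross_at_hi; have := ltn_ord i; lia.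
Qed.

Lemma of_pres_hom : sahom of_pres.
Proof. exact: quot_lift_hom of_pres_base_hom of_pres_base_rel. Qed.

Lemma of_pres_proj x : of_pres (quot_proj _ x) = of_pres_base x.
Proof. by apply: quot_lift_proj; [exact: of_pres_base_hom|exact: of_pres_base_rel]. Qed.

Lemma of_pres_pres_u j : (j.+1 < N)%N -> of_pres (pres_u F N j) = cross_at j.
Proof.
move=> h; have h1 : (j < N.-1)%N by lia.
by rewrite /pres_u (ext_lt _ _ h1) of_pres_proj of_pres_base_l of_pres_cox_u.
Qed.

Lemma of_pres_pres_x j : (j < N)%N -> of_pres (pres_x F N j) = dot_at j.
Proof. by move=> h; rewrite /pres_x (ext_lt _ _ h) of_pres_proj of_pres_base_x. Qed.

Lemma of_pres_tens_to_pres a : of_pres (tens_to_pres F a) = of_pres_tens a.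
Proof. by rewrite of_pres_proj of_pres_base_l of_pres_cox_A. Qed.

Lemma of_pres_pres_tok j a : (j < N)%N -> of_pres (pres_tok F N j a) = tok_at j a.
Proof. by move=> h; rewrite of_pres_tens_to_pres; apply: tensor_lift_tok tok_at_hom h. Qed.

(* As [m = n] is only propositional for a term of type [hterm A m n], its class
   as an endomorphism is taken through an equivalent term [f'] of square type. *)
Lemma of_pres_ev m n (f : hterm A m n) o l (f' : hterm A l l) :
  heq F f f' -> (o + l <= N)%N -> of_pres (ev F N f o) = hpad N o (hcls f' : nilHecke F l).
Proof.
elim: f o l f' => {m n} [m n|m n f IHf g IHg|m n f IH|m n c f IH|m n p f IH|n|
  m n r f IHf g IHg|m n m' n' f IHf g IHg|||a] o l f' e oN;
  (* Both ends of [f] are identified with [l], after which [f] can replace [f'] where its type is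
     already square. *)
  have [e1 e2 _] := heq_ev N e; subst;
  have hh := hpad_hom F oN; try rewrite -(heq_cls e).
- by rewrite (sahom0 of_pres_hom) [RHS](sahom0 hh).
- rewrite (sahomD of_pres_hom) (IHf _ _ f) ?(IHg _ _ g) //; try exact: heq_refl.
  by rewrite -(sahomD hh) -cls_hadd.
- rewrite (sahomN of_pres_hom) (IH _ _ f) //; last exact: heq_refl.
  by rewrite -(sahomN hh) -cls_hopp.
- rewrite (sahomZ of_pres_hom) (IH _ _ f) //; last exact: heq_refl.
  by rewrite -(sahomZ hh) -cls_hscale.
- rewrite (sahom_part of_pres_hom) (IH _ _ f) //; last exact: heq_refl.
  by rewrite -(sahom_part hh) -cls_hpart.
- by rewrite (sahom1 of_pres_hom) [RHS](sahom1 hh).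
- have [en|ne] := eqVneq l n; last first.
    by rewrite /= (ev_neq F N g) // smul0r (sahom0 of_pres_hom) -cls_hcomp
       (hhom_neq (hcls g)) // hcomp0r [RHS](sahom0 hh).
  subst n; rewrite (sahomM of_pres_hom) (IHf _ _ f) ?(IHg _ _ g) //; try exact: heq_refl.
  by rewrite -(sahomM hh) -cls_hcomp.
(* Here only [m + m' = n + n'] is known, so the factors need not be square. If [m] and [n] differ,
   both sides vanish, and the zero class is carried along [e2] to a zero term of square type. *)
- have [en|ne] := eqVneq m n; last first.
    rewrite /= (ev_neq F N f) // smul0l (sahom0 of_pres_hom).
    have /clsP z : hcls (HTens f g) = hcls (HZero A (m + m') (n + n')).
      by rewrite -cls_htens (hhom_neq (hcls f)) // htens0l.
    rewrite -(@heq_cls _ _ (HZero A (m + m') (m + m'))) ?[RHS](sahom0 hh) //.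
    by apply: heq_trans _ e; apply: heq_sym; apply: heq_trans z _; rewrite e2; apply: heq_refl.
  subst n; have en : m' = n' by lia.
  subst n'; rewrite -(heq_cls e) (sahomM of_pres_hom) (IHf _ _ f) ?(IHg _ _ g) //;
    try exact: heq_refl; try lia.
  by rewrite -cls_htens [RHS]hpad_tens.
- by apply: of_pres_pres_u; lia.
- by apply: of_pres_pres_x; lia.
- by apply: of_pres_pres_tok; lia.
Qed.

(** * Evaluation on endomorphisms and the two composites *)

Definition to_pres (x : H) : P := ev F N (rep x) 0.

Lemma to_pres_cls f : to_pres (hcls f) = ev F N f 0.
Proof.
have [_ _ e] := heq_ev N (hrep_cls F f); exact: (e 0%N (leqnn N)).
Qed.

Lemma to_pres_hom : sahom to_pres.
Proof.
split=> [c f g||f g|p f].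
- elim/cls_ind: f => f; elim/cls_ind: g => g.
  by rewrite -[X in to_pres X]/(hadd (hscale c _) _) cls_hscale cls_hadd !to_pres_cls.
- exact: to_pres_cls.
- elim/cls_ind: f => f; elim/cls_ind: g => g.
  by rewrite cls_smul !to_pres_cls.
- elim/cls_ind: f => f.
  by rewrite -[X in to_pres X]/(hpart p _) cls_hpart !to_pres_cls.
Qed.

(** In [1 ⊗ (f ⊗ 1_o)] the strands to the right of [f] shift its offset from 0 to [o], and
    identities have value 1. *)
Lemma to_pres_hpad o m (f : hterm A m m) : (o + m <= N)%N ->
  to_pres (hpad N o (hcls f : nilHecke F m)) = ev F N f o.
Proof.
move=> h; rewrite -(repK (hpad N o _)) to_pres_cls.
have [_ _ e] := heq_ev N (rep_hpad F f h).
by rewrite (e 0%N) //= smul1l smul1r.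
Qed.

Lemma to_presK : cancel to_pres of_pres.
Proof.
elim/cls_ind=> f; rewrite to_pres_cls (of_pres_ev (f' := f)) //; last exact: heq_refl.
(* Padding [N] strands into [N] at offset 0 adds an empty identity on both sides. *)
apply: hpad_heq => //; rewrite subnn.
by apply: heq_trans (heq_tens1l _ _) (heq_tens1r _ _).
Qed.

(** By [tprod_tok] a pure tensor is an ordered product of tokens, which reduces the claim to a token
    at one position. *)
Lemma to_pres_of_pres_tens a : to_pres (of_pres_tens a) = tens_to_pres F a.
Proof.
elim/tens_ind: a => [|c x y Hx Hy|f].
- by rewrite (sahom0 of_pres_tens_hom) (sahom0 to_pres_hom) (sahom0 (tens_to_pres_hom F N)).
- by rewrite (sahom_lin of_pres_tens_hom) (sahom_lin to_pres_hom)
    (sahom_lin (tens_to_pres_hom F N)) Hx Hy.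
rewrite -tprod_tok (sahom_ordprod _ _ of_pres_tens_hom) (sahom_ordprod _ _ to_pres_hom).
rewrite (sahom_ordprod _ _ (tens_to_pres_hom F N)); apply: eq_ordprod => j jn.
rewrite /= [of_pres_tens _](tensor_lift_tok _ tok_at_hom jn) [LHS]to_pres_hpad //; lia.
Qed.

(** P_N is a quotient of a free product one factor of which is again such a quotient. Applying
    [pres_hom_eq] once for each layer leaves tensors, crossings and dots. *)
Lemma of_presK : cancel of_pres to_pres.
Proof.
have E := sahom_comp to_pres_hom of_pres_hom.
have hq := quot_proj_hom (@nilHecke_rel k A eps F N).
have hc := nilCox_to_pres_hom F N.
have hcq := sahom_comp hc (quot_proj_hom (@nilCox_rel k A N)).
apply: (pres_hom_eq E (@sahom_id k P)) => s /=.
apply: (pres_hom_eq (sahom_comp E hq) hq) s => -[c|x] /=.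
- apply: (pres_hom_eq (sahom_comp E hc) hc) c => s /=.
  apply: (pres_hom_eq (sahom_comp E hcq) hcq) s => -[a|u] /=.
    by rewrite -[LHS]/(to_pres (of_pres (tens_to_pres F a)))
      of_pres_tens_to_pres to_pres_of_pres_tens.
  have cross_at := sahom_comp hcq (fp_inr_hom _ _).
  apply: (pres_hom_eq (sahom_comp E cross_at) cross_at) u => i.
  have hi := ltn_ord i; have hi' : (i.+1 < N)%N by lia.
  rewrite -[RHS]/(nilCox_to_pres F (nilCox_u A i)) -pres_uE.
  rewrite -[LHS]/(to_pres (of_pres (nilCox_to_pres F (nilCox_u A i)))) -pres_uE.
  by rewrite of_pres_pres_u // [LHS]to_pres_hpad //; lia.
have hf := free_to_pres_hom F N.
apply: (pres_hom_eq (sahom_comp E hf) hf) x => i.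
rewrite -[RHS]/(free_to_pres F (free_gen k _ i)) -pres_xE.
rewrite -[LHS]/(to_pres (of_pres (free_to_pres F (free_gen k _ i)))) -pres_xE.
by have hi := ltn_ord i; rewrite of_pres_pres_x // [LHS]to_pres_hpad //; lia.
Qed.
End Inverse.

Theorem proposition5p2 (k : comPzRingType) (A : superAlgType k) (eps : bool)
    (F : symFrobenius A eps) (n : nat) :
  superalg_iso (nilHecke F n) (nilHeckePres F n).
Proof.
have h := to_pres_hom F n.
pose f : {linear nilHecke F n -> nilHeckePres F n} :=
  HB.pack_for {linear nilHecke F n -> nilHeckePres F n} (@to_pres k A eps F n)
    (GRing.isLinear.Build k _ _ _ (@to_pres k A eps F n) (sahom_lin h)).
exists f; split.
- exact: sahom1 h.
- exact: sahomM h.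
- exact: sahom_part h.
- by exists (@of_pres k A eps F n); [apply: to_presK | apply: of_presK].
Qed.
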